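(* For the Fischer sporadic $3$-transposition groups $\operatorname{Fi}_{22}$, $\operatorname{Fi}_{23}$, $\operatorname{Fi}_{24}$ the following hold. (a) The codiagram of $\operatorname{Fi}_{22}$ is strongly regular with extended parameters $(3510,693,180,126;\ [63]^{429},[-9]^{3080})$. (b) The diagram of $\operatorname{Fi}_{22}$ is strongly regular with extended parameters $(3510,2816,2248,2304;\ [8]^{3080},[-64]^{429})$ and has spectrum $((2816;\ [8]^{3080},[-64]^{429}))$. (c) The codiagram of $\operatorname{Fi}_{23}$ is strongly regular with extended parameters $(31671,3510,693,351;\ [351]^{782},[-9]^{30888})$. (d) The diagram of $\operatorname{Fi}_{23}$ is strongly regular with extended parameters $(31671,28160,25000,25344;\ [8]^{30888},[-352]^{782})$ and has spectrum $((28160;\ [8]^{30888},[-352]^{782}))$. (e) The codiagram of $\operatorname{Fi}_{24}$ is strongly regular with extended parameters $(306936,31671,3510,3240;\ [351]^{57477},[-81]^{249458})$. (f) The diagram of $\operatorname{Fi}_{24}$ is strongly regular with extended parameters $(306936,275264,246832,247104;\ [80]^{249458},[-352]^{57477})$ and has spectrum $((275264;\ [80]^{249458},[-352]^{57477}))$.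
   Context: A $3$-transposition group $(G,D)$ is a group $G$ generated by a conjugacy class $D$ of elements of order $2$ such that $|de|\in\{1,2,3\}$ for all $d,e\in D$. Its diagram is the graph with vertex set $D$ in which $d,e$ are adjacent iff $|de|=3$; its codiagram is the complementary graph (distinct $d,e$ adjacent iff they commute). $\operatorname{Fi}_{22},\operatorname{Fi}_{23},\operatorname{Fi}_{24}$ are Fischer's three sporadic $3$-transposition groups ($\operatorname{Fi}_{24}$ being the full group containing its simple derived subgroup with index $2$); each has a generating class $D$ of $3$-transpositions, unique up to automorphism. Spectra are those of $(0,1)$-adjacency matrices, written $((k;\dots,[r]^c,\dots))$: the degree $k$, counted once, then the remaining eigenvalues, $[r]^c$ meaning $r$ with multiplicity $c$. A strongly regular graph with extended parameters $(n,k,\lambda,\mu;[r]^f,[s]^g)$ is a graph on $n$ vertices, regular of degree $k$, in which two distinct vertices have $\lambda$ common neighbors if adjacent and $\mu$ if not adjacent, and whose eigenvalues are $k$ (once), $r$ with multiplicity $f$ and $s$ with multiplicity $g$. *)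

(* Defs.v *)
From mathcomp Require Import all_boot all_order all_fingroup all_algebra.
From mathcomp Require Import all_solvable all_field.

Set Implicit Arguments.
Unset Strict Implicit.
Unset Printing Implicit Defensive.
Import GRing.Theory.
Set Warnings "-abstract-large-number".

Section Graphs.
Local Open Scope ring_scope.
Variables (T : finType) (e : rel T).

Definition regular_graph (k : nat) : Prop := forall x, #|[set y | e x y]| = k.

Definition adj_mx : 'M[algC]_#|T| :=
  \matrix_(i, j) (e (enum_val i) (enum_val j))%:R.

(* [has_spectrum k s] is ((k; ..., [r]^c, ...)), where [s] lists the pairs
   (r, c): the degree [k] is counted once, so it has one linear factor of its
   own, and [s] accounts for all other eigenvalues.  Multiplicities are those
   of the roots of the characteristic polynomial. *)
Definition has_spectrum (k : nat) (s : seq (int * nat)) : Prop :=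
  regular_graph k /\
  char_poly adj_mx =
    ('X - (k%:R)%:P) * \prod_(p <- s) ('X - (p.1%:~R)%:P) ^+ p.2.

Record is_srg (n k lam mu : nat) (rf sg : int * nat) : Prop := IsSrg {
  srg_sym : symmetric e;
  srg_irr : irreflexive e;
  srg_card : #|T| = n;
  srg_lam : forall x y, e x y -> #|[set z | e x z && e y z]| = lam;
  srg_mu : forall x y, x != y -> ~~ e x y -> #|[set z | e x z && e y z]| = mu;
  srg_spec : has_spectrum k [:: rf; sg]
}.

End Graphs.

Local Open Scope group_scope.

Record is_3transp (gT : finGroupType) (G : {group gT}) (D : {set gT}) : Prop :=
  Is3Transp {
    transp_class : D \in classes G;
    transp_gen : <<D>> = G;
    transp_order : {in D, forall d, #[d] = 2};
    transp_prod : {in D &, forall d e, #[d * e] \in [:: 1%N; 2; 3]}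
  }.

Definition diagram (gT : finGroupType) (D : {set gT}) : rel {d : gT | d \in D} :=
  [rel d e | #[val d * val e] == 3].

Definition codiagram (gT : finGroupType) (D : {set gT}) :
    rel {d : gT | d \in D} :=
  [rel d e | (d != e) && ~~ diagram d e].

Arguments diagram {gT} D.
Arguments codiagram {gT} D.

Definition pair_isog (gT hT : finGroupType) (G : {group gT}) (D : {set gT})
    (H : {group hT}) (E : {set hT}) : Prop :=
  exists2 f : {morphism G >-> hT}, isom G H f & f @* D = E.

(* the field with four elements, whose conjugation is x |-> x ^+ 2 *)
Definition F4 : finFieldType :=
  s2val (@pPrimePowerField 2 2 (erefl true) (erefl true)).

Lemma card_F4 : #|F4| = 4.
Proof. exact: (s2valP' (@pPrimePowerField 2 2 (erefl true) (erefl true))). Qed.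

Lemma pchar_F4 : 2 \in [pchar F4]%R.
Proof. exact: (s2valP (@pPrimePowerField 2 2 (erefl true) (erefl true))). Qed.

Definition conj_tr (A : 'M[F4]_6) : 'M[F4]_6 :=
  (map_mx (fun x => x ^+ 2)%R A)^T.

Definition SU6_2_set : {set {'GL_6[F4]}} :=
  [set u : {'GL_6[F4]} |
     (GLval u *m conj_tr (GLval u) == 1%:M)%R && (\det (GLval u) == 1)%R].

Lemma conj_trM (A B : 'M[F4]_6) :
  (conj_tr (A *m B) = conj_tr B *m conj_tr A)%R.
Proof.
have fE (C : 'M[F4]_6) :
    map_mx (fun x => x ^+ 2)%R C = map_mx (pFrobenius_aut pchar_F4) C.
  by apply/matrixP=> i j; rewrite !mxE.
by rewrite /conj_tr !fE map_mxM trmx_mul.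
Qed.

Lemma group_set_SU6_2 : group_set SU6_2_set.
Proof.
apply/group_setP; split=> [|u v].
  rewrite inE GL_1E det1 eqxx andbT /conj_tr; apply/eqP.
  rewrite mul1mx; apply/matrixP=> i j; rewrite !mxE eq_sym.
  by case: (i == j); rewrite ?expr1n ?expr0n.
rewrite !inE => /andP[/eqP uu /eqP du] /andP[/eqP vv /eqP dv].
rewrite GL_ME det_mulmx du dv mulr1 eqxx andbT.
by rewrite conj_trM mulmxA -(mulmxA (GLval u)) vv mulmx1 uu.
Qed.

Canonical SU6_2 : {group {'GL_6[F4]}} := Group group_set_SU6_2.

(* In SU_6(2) the elements u with rank (u - 1) = 1 are exactly the unitary
   transvections: the unitary homologies have determinant different from 1. *)
Definition SU6_2_transvections : {set {'GL_6[F4]}} :=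
  [set u in SU6_2 | \rank (GLval u - 1%:M)%R == 1%N].

Definition PSU6_2 := [group of SU6_2 / 'Z(SU6_2)].

Definition PSU6_2_transvections := SU6_2_transvections / 'Z(SU6_2).

(* The sporadic 3-transposition groups, as pairs (G, D), are given by Fischer's
   inductive description (the groups of type M(22), M(23), M(24)), which
   determines each pair up to isomorphism: for d in D, the quotient C_G(d)/<d>,
   together with the image of the transpositions other than d commuting with d,
   is PSU_6(2) with its transvections for Fi_22, is Fi_22 for Fi_23, and is
   Fi_23 for Fi_24.
   See M. Aschbacher, 3-Transposition Groups. *)

Definition transp_cent (gT : finGroupType) (G : {group gT}) (d : gT) :=
  [group of 'C_G[d] / <[d]>].

Definition transp_link (gT : finGroupType) (D : {set gT}) (d : gT) :=
  ('C_D[d] :\ d) / <[d]>.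

Definition is_Fi22 (gT : finGroupType) (G : {group gT}) (D : {set gT}) : Prop :=
  [/\ is_3transp G D, simple G &
      {in D, forall d, pair_isog (transp_cent G d) (transp_link D d)
                                 PSU6_2 PSU6_2_transvections}].

Definition is_Fi23 (gT : finGroupType) (G : {group gT}) (D : {set gT}) : Prop :=
  [/\ is_3transp G D, simple G &
      {in D, forall d, is_Fi22 (transp_cent G d) (transp_link D d)}].

Definition is_Fi24 (gT : finGroupType) (G : {group gT}) (D : {set gT}) : Prop :=
  [/\ is_3transp G D, simple G^`(1), #|G : G^`(1)| = 2 &
      {in D, forall d, is_Fi23 (transp_cent G d) (transp_link D d)}].

(* Main.v *)
Require Import Defs.
From Stdlib Require Import ZArith.
From mathcomp Require Import all_boot all_order all_fingroup all_algebra.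
From mathcomp Require Import center commutator gseries cyclic finfield algC.
From mathcomp Require Import zify ring.
Set Warnings "-abstract-large-number".

(* Let E be a set of 3-transpositions and suppose that, for each c in E, the
   commuting graph on the set E_c of elements other than c commuting with c is
   strongly regular with parameters (k, l, l', m').  For noncommuting d, e let
   M(e) = E_d :&: E_e.  Under the group generated by the elements of E that
   commute with d, two elements x, y not commuting with d either are conjugate
   or have comparable M(x), M(y); as that group is transitive on E_d, all
   nonempty M(e) have the same size m, and the components of the commuting
   graph have diameter 2.  When E generates an (almost) simple group there is
   only one component, so E is strongly regular with k(k - 1 - l) = m(n - 1 - k).
   Inside E_d the set M(e) is regular of degree m', so Cauchy-Schwarz applied
   to the numbers of neighbours in M(e) bounds m; together with divisibility and
   the integrality of the eigenvalues this leaves m = 351 for Fi_23, m = 3240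
   for Fi_24, and m = 126 or 198 for Fi_22.  In the last case M(e) is itself a
   set of 3-transpositions with local parameters (45, 12, 3, 3), and the same
   analysis applied to it excludes 198.  The induction starts from the isotropic
   points of the unitary space F_4^6, counted by quadratic character sums. *)

Set Implicit Arguments.
Unset Strict Implicit.
Unset Printing Implicit Defensive.

(** Cauchy-Schwarz against the constant 1: after doubling, both sides are double sums over [B],
    compared termwise by 2ab <= a^2 + b^2. *)
Lemma sum_sqr_le (I : finType) (B : {set I}) (t : I -> nat) :
  (\sum_(i in B) t i) ^ 2 <= #|B| * \sum_(i in B) t i ^ 2.
Proof.
rewrite -(leq_pmul2l (isT : 0 < 2)) -mulnn big_distrlr /=.
have -> : 2 * (#|B| * \sum_(i in B) t i ^ 2) =
          \sum_(i in B) \sum_(j in B) (t i ^ 2 + t j ^ 2).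
  under [RHS]eq_bigr do rewrite big_split /= sum_nat_const.
  by rewrite big_split /= -big_distrr /= sum_nat_const addnn mul2n.
rewrite big_distrr; apply: leq_sum => i _; rewrite big_distrr.
by apply: leq_sum => j _; apply: nat_Cauchy.
Qed.

(** * Commuting graphs on sets of 3-transpositions *)

Section TranspositionSets.
Import GroupScope.

Definition com (gT : finGroupType) (x y : gT) := x * y == y * x.

Definition nb (gT : finGroupType) (E : {set gT}) (x : gT) :=
  [set y in E | (y != x) && com x y].

(** Strong regularity of the commuting graph on [E], the spectrum left aside; noncommuting elements
    are automatically distinct. *)
Record srgset (gT : finGroupType) (E : {set gT}) (n k l m : nat) : Prop :=
  Srgset {
    srgset_card : #|E| = n;
    srgset_deg : forall x, x \in E -> #|nb E x| = k;
    srgset_lam : forall x y, x \in E -> y \in nb E x ->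
      #|nb E x :&: nb E y| = l;
    srgset_mu : forall x y, x \in E -> y \in E -> ~~ com x y ->
      #|nb E x :&: nb E y| = m }.

(* For noncommuting involutions, x ^ y = y ^ x says that x * y has order 3. *)
Record transp_set (gT : finGroupType) (E : {set gT}) : Prop := TranspSet {
  transp_set_inv : forall x, x \in E -> x * x = 1;
  transp_setJ : forall x y, x \in E -> y \in E -> x ^ y \in E;
  transp_set_braid : forall x y, x \in E -> y \in E -> ~~ com x y -> x ^ y = y ^ x }.

Lemma invg_invol (gT : finGroupType) (x : gT) : x * x = 1 -> x^-1 = x.
Proof. by move=> xx; apply/eqP; rewrite eq_invg_mul xx. Qed.

Section Com.
Variable gT : finGroupType.
Implicit Types (x y z c g : gT) (E : {set gT}).

Lemma comC x y : com x y = com y x.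
Proof. by rewrite /com eq_sym. Qed.

Lemma com_refl x : com x x.
Proof. exact: eqxx. Qed.

Lemma comJ x y g : com (x ^ g) (y ^ g) = com x y.
Proof. by rewrite /com -!conjMg (inj_eq (conjg_inj g)). Qed.

Lemma comP x y : reflect (x ^ y = x) (com x y).
Proof.
apply: (iffP eqP) => [xy|xy]; first by rewrite conjgE xy mulKg.
by rewrite conjgC xy.
Qed.

Lemma cent1_com x y : (x \in 'C[y]) = com x y.
Proof. by apply/cent1P/eqP. Qed.

Lemma in_nb E x y : (y \in nb E x) = [&& y \in E, y != x & com x y].
Proof. by rewrite inE. Qed.

Lemma nb_sub E x : nb E x \subset E.
Proof. by apply/subsetP => y; rewrite inE => /and3P[]. Qed.

(** Turns degrees in the local graph at [c] into numbers of common neighbours in [E]. *)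
Lemma nb_nb E c x : x \in nb E c -> nb (nb E c) x = nb E c :&: nb E x.
Proof.
move=> xc; apply/setP => y; rewrite !inE.
by case: (y \in E) => //=; rewrite andbA.
Qed.

Lemma nbC E x y : x \in E -> y \in nb E x -> x \in nb E y.
Proof.
by rewrite !in_nb => -> /and3P[_ yx xy] /=; rewrite eq_sym yx comC.
Qed.

Lemma nbJ E x g : g \in 'N(E) -> nb E (x ^ g) = nb E x :^ g.
Proof.
move=> gN; apply/setP=> y; rewrite mem_conjg !in_nb.
rewrite -[y in LHS](conjgKV g) memJ_norm // (inj_eq (conjg_inj g)).
by rewrite comJ.
Qed.

End Com.

(** * Cauchy-Schwarz bound for a subset of constant inner degree *)

Section SubBound.
Variables (gT : finGroupType) (P M : {set gT}) (k l l' m' : nat).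
Hypotheses (srgP : srgset P k l l' m') (sMP : M \subset P).
Hypothesis degM : forall x, x \in M -> #|nb P x :&: M| = m'.

Let nb_sym x y : x \in P -> y \in P -> (x \in nb P y) = (y \in nb P x).
Proof. by move=> xP yP; rewrite !in_nb xP yP eq_sym comC. Qed.

Let t p := #|nb P p :&: M|.

Let tE p : p \in P -> t p = \sum_(x in M) (p \in nb P x).
Proof.
move=> pP; rewrite /t setIC -sum1_card big_mkcond [RHS]big_mkcond /=.
apply: eq_bigr => x _; rewrite inE.
by case: (boolP (x \in M)) => //= xM; rewrite nb_sym // (subsetP sMP).
Qed.

Let sum_in (X : {set gT}) : X \subset P -> \sum_(p in P) (p \in X : nat) = #|X|.
Proof.
move=> sXP; rewrite -sum1_card big_mkcond [RHS]big_mkcond /=.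
apply: eq_bigr => p _; case: (boolP (p \in X)) => [/(subsetP sXP) ->//|_].
by case: ifP.
Qed.

Let sum_t : \sum_(p in P) t p = (#|M| * l)%N.
Proof.
rewrite (eq_bigr _ tE) exchange_big /= -sum_nat_const.
apply: eq_bigr => x xM; rewrite sum_in ?nb_sub //.
by rewrite (srgset_deg srgP) ?(subsetP sMP).
Qed.

Let sum_t2 : \sum_(p in P) (t p ^ 2)%N =
  \sum_(x in M) \sum_(y in M) #|nb P x :&: nb P y|.
Proof.
under eq_bigr => p pP do rewrite (tE pP) -mulnn big_distrlr /=.
rewrite exchange_big; apply: eq_bigr => x xM.
rewrite exchange_big; apply: eq_bigr => y yM /=.
rewrite -sum_in; last by apply: subset_trans (nb_sub P x); apply: subsetIl.
by apply: eq_bigr => p _; rewrite [p \in _ :&: _]inE mulnb.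
Qed.

(** [M] consists of [x], its [m'] neighbours in [M] and the remaining elements, which share [l],
    [l'] and [m'] neighbours with [x] respectively. *)
Let sum_com x : x \in M ->
  (\sum_(y in M) #|nb P x :&: nb P y| + (1 + m') * m' =
   l + m' * l' + #|M| * m')%N.
Proof.
move=> xM; have xP := subsetP sMP x xM.
have cM := cardsID (nb P x) (M :\ x).
have eI : (M :\ x) :&: nb P x = nb P x :&: M.
  apply/setP=> y; rewrite !inE; case: (y == x) => //=; last exact: andbC.
  by rewrite andbF.
rewrite eI degM // in cM.
have cMx := cardsD1 x M; rewrite xM in cMx.
rewrite (big_setD1 x) //= setIid (srgset_deg srgP) //.
rewrite (big_setID (nb P x)) /= eI.
rewrite (eq_bigr (fun=> l')); last first.
  by move=> y /setIP[xy _]; rewrite (srgset_lam srgP).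
rewrite [X in _ + (_ + X)](eq_bigr (fun=> m')); last first.
  move=> y; rewrite !inE => /and3P[nxy yx yM]; have yP := subsetP sMP y yM.
  by rewrite (srgset_mu srgP) //; move: nxy; rewrite yP yx.
rewrite !sum_nat_const degM //.
by rewrite cMx -cM; nia.
Qed.

(* T and Q are the sums of t and of t^2 over P :\: M, and the last inequality is
   Cauchy-Schwarz; the equations are stated without subtraction. *)
Lemma srgset_sub_bound : exists T Q : nat,
  [/\ T + #|M| * m' = #|M| * l,
      Q + #|M| * (m' * m') + #|M| * ((1 + m') * m') =
        #|M| * (l + m' * l' + #|M| * m')
    & T * T <= (k - #|M|) * Q]%N.
Proof.
exists (\sum_(p in P :\: M) t p), (\sum_(p in P :\: M) (t p ^ 2)%N).
have ePM : P :&: M = M by apply/setIidPr.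
split.
- rewrite -sum_t [RHS](big_setID M) /= ePM addnC; congr (_ + _)%N.
  by rewrite -sum_nat_const; apply: eq_bigr => x xM; rewrite /t degM.
- have <- : (\sum_(x in M) t x ^ 2 = #|M| * (m' * m'))%N.
    rewrite -sum_nat_const; apply: eq_bigr => x xM.
    by rewrite /t degM // mulnn.
  have := sum_t2; rewrite (big_setID M) /= ePM addnC => ->.
  by rewrite -!sum_nat_const -big_split /=; apply: eq_bigr => x xM;
    rewrite sum_com // sum_nat_const.
- have := sum_sqr_le (P :\: M) t.
  by rewrite cardsD ePM (srgset_card srgP) mulnn.
Qed.

End SubBound.

(** * Components of a commuting graph with given local parameters *)

Section Extension.
Variables (gT : finGroupType) (E : {set gT}) (k l l' m' : nat).
Hypothesis tE : transp_set E.
Hypothesis loc : forall c, c \in E -> srgset (nb E c) k l l' m'.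
Hypotheses (lt_m'l : m' < l) (lt_2lk : 2 * l + 2 < k).

Let EE x : x \in E -> x * x = 1. Proof. exact: transp_set_inv. Qed.
Let EJ x y : x \in E -> y \in E -> x ^ y \in E. Proof. exact: transp_setJ. Qed.
Let br x y : x \in E -> y \in E -> ~~ com x y -> x ^ y = y ^ x.
Proof. exact: transp_set_braid. Qed.

Let JK x y : x \in E -> (y ^ x) ^ x = y.
Proof. by move=> xE; rewrite -conjgM EE // conjg1. Qed.

(** [x], [y] and [x ^ y] are the three involutions of a symmetric group of degree 3, where
    conjugation by one exchanges the other two. *)
Lemma braidJ x y : x \in E -> y \in E -> ~~ com x y -> x ^ (x ^ y) = y.
Proof.
move=> xE yE nc; rewrite (br xE yE nc) -{1}(comP _ _ (com_refl x)) -conjJg.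
by rewrite (br xE yE nc) JK.
Qed.

(** Conjugation by [c] turns the claim into the commutation of [y ^ c = c ^ y] with [x ^ y], which
    is that of [c] with [x] conjugated by [y]. *)
Lemma com_braid x y c : x \in E -> y \in E -> c \in E ->
  com x c -> ~~ com x y -> ~~ com y c -> com y ((x ^ y) ^ c).
Proof.
move=> xE yE cE xc xy yc.
by rewrite -(comJ _ _ c) JK // br // comJ comC.
Qed.

Lemma com_conj2 x c d : x \in E -> c \in E -> d \in E ->
  com c d -> ~~ com x c -> ~~ com x d -> com x ((x ^ c) ^ d).
Proof.
move=> xE cE dE cd xc xd; rewrite -(comJ _ _ d) JK //.
by rewrite br // (br xE cE) // comJ comC.
Qed.

Section Fixd.
Variable d : gT.
Hypothesis dE : d \in E.

Let K := [group of <<E :&: 'C[d]>>].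
Let M e := nb E d :&: nb E e.
Let sim e e' := e' \in orbit 'J K e.

Let KN : K \subset 'N(E).
Proof.
rewrite gen_subG; apply/subsetP => x /setIP[xE _].
by rewrite inE; apply/subsetP => y /imsetP[z zE ->]; apply: EJ.
Qed.

Let Kd g : g \in K -> d ^ g = d.
Proof.
have KC : K \subset 'C[d] by rewrite gen_subG subsetIr.
by move/(subsetP KC); rewrite cent1_com comC => /comP.
Qed.

Let simJ e c : c \in E -> com d c -> sim e (e ^ c).
Proof.
move=> cE dc; apply: (mem_orbit 'J e).
by apply: mem_gen; rewrite inE cE cent1_com comC.
Qed.

Let sim_sym e e' : sim e e' = sim e' e. Proof. exact: orbit_sym. Qed.

Let sim_trans e2 e1 e3 : sim e1 e2 -> sim e2 e3 -> sim e1 e3.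
Proof. by move=> h1 h2; apply: orbit_trans h2 h1. Qed.

Let simP e e' : sim e e' -> exists2 g, g \in K & e' = e ^ g.
Proof. by case/imsetP => g gK ->; exists g. Qed.

Let MJ e g : g \in K -> M (e ^ g) = M e :^ g.
Proof.
move=> gK; have gN := subsetP KN g gK.
by rewrite /M nbJ // -{1}(Kd gK) nbJ // conjIg.
Qed.

Let sim_cardM e e' : sim e e' -> #|M e| = #|M e'|.
Proof. by case/simP => g gK ->; rewrite MJ // cardJg. Qed.

Let A e := (e \in E) && ~~ com d e.

Let AE e : A e -> e \in E. Proof. by case/andP. Qed.
Let AN e : A e -> ~~ com d e. Proof. by case/andP. Qed.

(** The conjugating element is the product of [(e ^ d) ^ e'], which commutes with [d] by
    [com_braid], and of [d] itself. *)
Let sim_com e e' : A e -> A e' -> com e e' -> sim e e'.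
Proof.
move=> /andP[eE de] /andP[e'E de'] ee'.
have c_d : com d ((e ^ d) ^ e') by apply: com_braid; rewrite // comC.
(* As [e'] fixes [e], the inner conjugate is [(e ^ (e ^ d)) ^ e' = d ^ e' = e' ^ d]. *)
have -> : e' = (e ^ ((e ^ d) ^ e')) ^ d.
  rewrite -{1}(comP _ _ ee') -conjJg braidJ // ?(comC e) //.
  by rewrite (br dE e'E de') JK.
apply: sim_trans (simJ (_ ^ _) dE (com_refl d)).
by apply: simJ => //; rewrite !EJ.
Qed.

Let in_M e c : (c \in M e) = [&& c \in E, c != d, com d c, c != e & com e c].
Proof. by rewrite inE !in_nb; case: (c \in E); rewrite /= -?andbA. Qed.

(* The witness is z = (x ^ y) ^ c: it is conjugate to x ^ y by c, and it commutes
   with y, hence is conjugate to y. *)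
Let sim_step x y c : A x -> A y -> c \in M x -> ~~ com y c -> ~~ com x y ->
  A (x ^ y) -> sim y (x ^ y).
Proof.
move=> Ax Ay; rewrite in_M => /and5P[cE cd dc cx xc] yc xy Axy.
apply: (@sim_trans ((x ^ y) ^ c)); last first.
  by rewrite sim_sym simJ.
apply: sim_com => //; last by apply: com_braid => //; apply: AE.
case/andP: Axy => h1 h2; apply/andP; split; first exact: EJ.
by rewrite -(comP _ _ dc) comJ.
Qed.

(** If neither set contained the other, there would be [c] in [M x] not commuting with [y] and [c']
    in [M y] not commuting with [x]; two uses of [sim_step] then link [x] and [y] through
    [x ^ y]. *)
Let M_comparable x y : A x -> A y -> ~~ sim x y ->
  (M x \subset M y) || (M y \subset M x).
Proof.
move=> Ax Ay nsim.
have xy : ~~ com x y by apply: contraNN nsim; apply: sim_com.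
(* Otherwise [x ^ y] lies in [K], and by [braidJ] it conjugates [x] to [y]. *)
have Axy : A (x ^ y).
  apply/andP; split; first by apply: EJ; apply: AE.
  apply: contra nsim => c; rewrite -(braidJ (AE Ax) (AE Ay) xy).
  by apply: simJ => //; apply: EJ; apply: AE.
have sub u v : A u -> A v -> ~~ com u v -> M u \subset M v \/
    exists2 c, c \in M u & ~~ com v c.
  move=> Au Av uv; case: (boolP (M u \subset M v)) => [|/subsetPn[c cu cv]].
    by left.
  right; exists c => //; apply: contra cv => vc.
  move: (cu); rewrite !in_M vc => /and5P[-> -> -> _ uc] /=; rewrite andbT.
  by apply: contraNneq uv => <-.
case: (sub x y Ax Ay xy) => [->//|[c cx yc]].
have yx : ~~ com y x by rewrite comC.
case: (sub y x Ay Ax yx) => [->|[c' c'y xc']]; first by rewrite orbT.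
case/negP: nsim; apply: (@sim_trans (x ^ y)).
  rewrite br //; [|exact: AE|exact: AE].
  by apply: (sim_step Ay Ax c'y) => //; rewrite -br //; apply: AE.
by rewrite sim_sym; apply: (sim_step Ax Ay cx).
Qed.

(** Two closed neighbourhoods in the local graph at [d] cover at most 2(l + 1) of its k vertices. *)
Let nb_far a b : a \in nb E d -> b \in nb E d ->
  exists2 c, c \in nb E d & ~~ com a c && ~~ com b c.
Proof.
move=> ad bd; have [_ deg _ _] := loc dE.
pose X := (a |: nb (nb E d) a) :|: (b |: nb (nb E d) b).
have cX : #|X| < #|nb E d|.
  rewrite (srgset_card (loc dE)); apply: leq_ltn_trans lt_2lk.
  apply: leq_trans (leq_card_setU _ _) _; rewrite !cardsU1 !deg //.
  by do 2!case: (_ \notin _); lia.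
have /subsetPn[c cd] : ~~ (nb E d \subset X).
  by apply: contraL cX => /subset_leq_card; rewrite leqNgt.
have far u : c \notin u |: nb (nb E d) u -> ~~ com u c.
  by rewrite in_setU1 negb_or in_nb cd => /andP[-> /=].
by rewrite in_setU negb_or => /andP[/far ac /far bc]; exists c; rewrite // ac.
Qed.

(** Noncommuting [u], [v] are conjugate under [u ^ v], which commutes with [d]; an arbitrary pair is
    linked through the element given by [nb_far]. *)
Let nb_sim a b : a \in nb E d -> b \in nb E d -> sim a b.
Proof.
have nsim u v : u \in nb E d -> v \in nb E d -> ~~ com u v -> sim u v.
  rewrite !in_nb => /and3P[uE ud du] /and3P[vE vd dv] uv.
  rewrite -(braidJ uE vE uv); apply: simJ; first exact: EJ.
  by rewrite -(comP _ _ dv) comJ.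
move=> ad bd; have [c cd /andP[ac bc]] := nb_far ad bd.
by apply: sim_trans (nsim a c _ _ ac) _; rewrite // sim_sym nsim.
Qed.

(* If M x were nb E d, then for c in M x the noncommuting elements d, x of nb E c
   would have l common neighbours there instead of m'. *)
Let M_proper x : A x -> M x != nb E d.
Proof.
move=> Ax; apply/negP => /eqP eM.
have: 0 < #|nb E d| by rewrite (srgset_card (loc dE)); lia.
case/card_gt0P => c cd; have cE : c \in E by move: cd; rewrite in_nb => /and3P[].
have dc := nbC dE cd.
have xc : x \in nb E c.
  by apply: nbC; [exact: AE|move: cd; rewrite -eM => /setIP[]].
have := srgset_mu (loc cE) dc xc (AN Ax); rewrite !nb_nb //.
have -> : nb E c :&: nb E d :&: (nb E c :&: nb E x) =
          nb E c :&: nb E d.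
  by rewrite -setIA (setICA (nb E d)) setIA setIid -/(M x) eM.
by rewrite -nb_nb // (srgset_deg (loc cE)) // => h; move: lt_m'l; rewrite h ltnn.
Qed.

(** If [x] and [y] are not conjugate and [M x] is the larger set, comparability puts [M y] inside
    [M (x ^ g)] for every [g] in [K]. As [K] is transitive on [nb E d], one element of [M y] then
    forces [M x] to be all of [nb E d], against [M_proper]. *)
Let sim_M x y : A x -> A y -> M x != set0 -> M y != set0 -> sim x y.
Proof.
wlog le_yx : x y / #|M y| <= #|M x|.
  move=> W Ax Ay Mx My; case/orP: (leq_total #|M y| #|M x|) => h; first exact: W.
  by rewrite sim_sym; apply: W.
move=> Ax Ay Mx My; case: (boolP (sim x y)) => // nsim.
have sub g : g \in K -> M y \subset M (x ^ g).
  move=> gK; have xg : sim x (x ^ g) by apply: (mem_orbit 'J x gK).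
  have Axg : A (x ^ g).
    apply/andP; split; first by rewrite memJ_norm ?AE // (subsetP KN).
    by rewrite -(Kd gK) comJ AN.
  have : ~~ sim (x ^ g) y by apply: contra nsim; apply: sim_trans.
  case/(M_comparable Axg Ay)/orP => // h.
  suff /eqP -> : M (x ^ g) == M y by [].
  by rewrite eqEcard h -(sim_cardM xg).
have /set0Pn[c cy] := My; case/negP: (M_proper Ax).
rewrite eqEsubset subsetIl; apply/subsetP => a ad.
have cd : c \in nb E d by case/setIP: cy.
have /simP[g gK ->] := nb_sim cd ad.
have := subsetP (sub g^-1 (groupVr gK)) c cy.
by rewrite MJ ?groupV // mem_conjgV.
Qed.

Lemma common_nb_const x y : x \in E -> y \in E -> ~~ com d x -> ~~ com d y ->
  nb E d :&: nb E x != set0 -> nb E d :&: nb E y != set0 ->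
  #|nb E d :&: nb E x| = #|nb E d :&: nb E y|.
Proof.
by move=> xE yE dx dy Mx My; apply/sim_cardM/sim_M; rewrite // /A ?xE ?yE.
Qed.

Lemma common_nb_com x y : x \in E -> y \in E -> ~~ com d x -> ~~ com d y ->
  com x y -> #|nb E d :&: nb E x| = #|nb E d :&: nb E y|.
Proof.
move=> xE yE dx dy xy.
by apply/sim_cardM/sim_com; rewrite // /A ?xE ?yE.
Qed.

End Fixd.

Lemma common_nb_bound d e : d \in E -> e \in E -> ~~ com d e ->
  let m := #|nb E d :&: nb E e| in
  exists T Q : nat,
  [/\ T + m * m' = m * l,
      Q + m * (m' * m') + m * ((1 + m') * m') = m * (l + m' * l' + m * m')
    & T * T <= (k - m) * Q]%N.
Proof.
move=> dE eE de /=.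
apply: (srgset_sub_bound (loc dE)); first exact: subsetIl.
(* The neighbours of [x] inside the set are the common neighbours of the noncommuting elements [d]
   and [e] in the local graph at [x]. *)
move=> x /setIP[dx ex].
have xE : x \in E by apply: (subsetP (nb_sub E d)).
have xd := nbC dE dx; have xe := nbC eE ex.
rewrite nb_nb //.
have -> : nb E d :&: nb E x :&: (nb E d :&: nb E e) =
          nb (nb E x) d :&: nb (nb E x) e.
  rewrite (nb_nb xd) (nb_nb xe).
  by rewrite setIACA setIid [RHS]setIACA setIid setICA.
exact: (srgset_mu (loc xE)).
Qed.

(** Distance at most 2 in the commuting graph; transitivity below makes this the relation of lying
    in the same component. *)
Definition near d e := com d e || (nb E d :&: nb E e != set0).

Lemma near_refl d : near d d.
Proof. by rewrite /near com_refl. Qed.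

Lemma near_sym d e : near d e = near e d.
Proof. by rewrite /near comC setIC. Qed.

(** The reason for diameter 2: if [d] commutes with neither [f] nor [g], then [f] and [g] have
    equally many common neighbours with [d], so a path of length 3 can be shortened. *)
Lemma near_com d f g : d \in E -> f \in E -> g \in E ->
  near d f -> com f g -> near d g.
Proof.
move=> dE fE gE df fg; rewrite /near; case: (boolP (com d g)) => //= dg.
case: (boolP (com d f)) df => [dcf _|dcf]; rewrite /near ?(negPf dcf) /=.
  apply/set0Pn; exists f; rewrite inE !in_nb fE dcf (comC g) fg /= !andbT.
  by apply/andP; split; apply: contraNneq dg => h; rewrite -?h // h.
by rewrite -!card_gt0 (common_nb_com dE fE gE).
Qed.

Lemma near_trans d f g : d \in E -> f \in E -> g \in E ->
  near d f -> near f g -> near d g.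
Proof.
move=> dE fE gE df /orP[|/set0Pn[c /setIP[fc gc]]]; first exact: near_com df.
have cE : c \in E by apply: (subsetP (nb_sub E f)).
apply: (near_com dE cE gE); last by move: gc; rewrite in_nb comC => /and3P[].
by apply: (near_com dE fE cE) => //; move: fc; rewrite in_nb => /and3P[].
Qed.

Lemma nearJ d e g : g \in 'N(E) -> near (d ^ g) (e ^ g) = near d e.
Proof.
move=> gN; rewrite /near comJ !nbJ // -conjIg; congr (_ || ~~ _).
by rewrite -!cards_eq0 cardJg.
Qed.

(** Counts the edges between [nb E d] and the elements not commuting with [d]: the k neighbours of
    [c] are [d], the l common with [d], and k - 1 - l others. *)
Lemma common_nb_sum d : d \in E ->
  \sum_(e in E | ~~ com d e) #|nb E d :&: nb E e| = (k * (k - 1 - l))%N.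
Proof.
move=> dE.
have -> : (k * (k - 1 - l) = \sum_(c in nb E d) (k - 1 - l))%N.
  by rewrite sum_nat_const (srgset_card (loc dE)).
transitivity (\sum_(c in nb E d) #|[set e in nb E c | ~~ com d e]|); last first.
  apply: eq_bigr => c dc; have cE : c \in E by apply: (subsetP (nb_sub E d)).
  have cd := nbC dE dc.
  rewrite -{1}(srgset_card (loc cE)) -(srgset_deg (loc cE) cd) nb_nb //.
  rewrite (cardsD1 d (nb E c)) cd add1n subn1 /=.
  rewrite -(cardsID (nb E d) (nb E c :\ d)).
  have -> : (nb E c :\ d) :&: nb E d = nb E c :&: nb E d.
    by apply/setP=> y; rewrite !inE; case: (y == d); rewrite /= ?andbF.
  rewrite addKn; apply: eq_card => y; rewrite !inE.
  case: (eqVneq y d) => [->|] /=; first by rewrite com_refl !andbF.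
  by case: (y \in E) => //=; rewrite andbC.
have cE (X Y : {set gT}) : #|X :&: Y| = \sum_(c in X) (c \in Y).
  rewrite -sum1_card big_mkcond [RHS]big_mkcond /=.
  by apply: eq_bigr => c _; rewrite inE; case: (c \in X); case: (c \in Y).
under eq_bigr do rewrite cE.
rewrite exchange_big /=; apply: eq_bigr => c dc.
have cE' : c \in E by apply: (subsetP (nb_sub E d)).
rewrite -sum1_card big_mkcond [RHS]big_mkcond /=.
apply: eq_bigr => e _; rewrite !inE.
case: (e \in E) => //=; case: (com d e) => //=; rewrite ?andbF ?cE' //=.
by rewrite eq_sym comC andbT; case: (_ && _).
Qed.

(** [n2] is the number of elements at distance 2 from [d]. There are some, since the edge count k(k
    - 1 - l) is positive, and each has the same number [m] of common neighbours with [d]. *)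
Lemma component_param d : d \in E -> exists m n2 : nat,
  [/\ (m * n2 = k * (k - 1 - l))%N,
      #|[set e in E | near d e]| = (1 + k + n2)%N,
      exists2 e, e \in E & ~~ com d e && (#|nb E d :&: nb E e| == m)
    & forall e, e \in E -> ~~ com d e -> near d e -> #|nb E d :&: nb E e| = m].
Proof.
move=> dE; have S := common_nb_sum dE.
pose X := [set e in E | ~~ com d e && (nb E d :&: nb E e != set0)].
have eS : \sum_(e in X) #|nb E d :&: nb E e| = (k * (k - 1 - l))%N.
  rewrite -S big_mkcond [RHS]big_mkcond /=; apply: eq_bigr => e _; rewrite !inE.
  case: (e \in E); case: (com d e) => //=.
  by case: eqP => //= ->; rewrite cards0.
case: (set_0Vmem X) => [X0|[e0 e0X]].
  by move: eS; rewrite X0 big_set0; nia.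
have Xm e : e \in X -> #|nb E d :&: nb E e| = #|nb E d :&: nb E e0|.
  move: e0X; rewrite !inE => /and3P[e0E de0 M0] /and3P[eE de Me].
  exact: common_nb_const.
exists #|nb E d :&: nb E e0|, #|X|; split.
- by rewrite -eS (eq_bigr _ Xm) sum_nat_const mulnC.
- rewrite -(srgset_card (loc dE)) (cardsD1 d) inE dE near_refl -addnA.
  congr (_ + _)%N; rewrite -(cardsID [set e | com d e]); congr (_ + _)%N.
    apply: eq_card => e; rewrite !inE /near.
    by case: (com d e); rewrite ?andbF ?andbT //= andbC.
  apply: eq_card => e; rewrite !inE /near.
  case: (boolP (com d e)); rewrite ?andbF ?andbT //= => de.
  by case: eqVneq de => [->|//]; rewrite com_refl.
- exists e0; move: e0X; rewrite inE => /and3P[//].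
  by move=> _ ->; rewrite eqxx.
move=> e eE de; rewrite /near (negPf de) /= => Me.
by apply: Xm; rewrite inE eE de.
Qed.

End Extension.

(** A product of order 1 or 2 means that the involutions commute; for order 3, (xy)^3 = 1 reads xyx
    = yxy, that is, [y ^ x = x ^ y]. *)
Lemma transp_set_of (gT : finGroupType) (G : {group gT}) (D : {set gT}) :
  is_3transp G D -> transp_set D.
Proof.
move=> [clD genD ordD prodD].
have inv d : d \in D -> d * d = 1.
  by move=> /ordD od; rewrite -expg2 -od expg_order.
have normD x y : x \in D -> y \in D -> x ^ y \in D.
  move=> xD yD; have yG : y \in G by rewrite -genD mem_gen.
  case/imsetP: clD xD => a aG ->; case/imsetP => b bG ->.
  by rewrite -conjgM; apply: imset_f; rewrite groupM.
split=> // x y xD yD; have := prodD x y xD yD.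
have ix := inv x xD; have iy := inv y yD.
have invE := @invg_invol gT.
rewrite !inE => /or3P[] /eqP o; have := expg_order (x * y); rewrite o /com.
- rewrite expg1 => /eqP; rewrite -eq_invg_mul invE // => /eqP <-.
  by rewrite eqxx.
- rewrite expg2 => /eqP; rewrite -eq_invg_mul invMg !invE // => /eqP ->.
  by rewrite eqxx.
rewrite expgSr expg2 => h _.
have : (x * y * x)^-1 = y * x * y.
  by apply/eqP; rewrite eq_invg_mul !mulgA; move: h; rewrite !mulgA => ->.
by rewrite !conjgE !invMg !invE // !mulgA.
Qed.

(** * Connectedness of the commuting graph when the products of transpositions lie in a simple
    normal subgroup *)

Section Fischer.
Variables (gT : finGroupType) (G S : {group gT}) (D : {set gT}).
Variables (k l l' m' : nat).
Hypothesis tG : is_3transp G D.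
Hypotheses (simS : simple S) (nSG : S <| G).
Hypothesis prodS : forall d e, d \in D -> e \in D -> d * e \in S.
Hypothesis loc : forall c, c \in D -> srgset (nb D c) k l l' m'.
Hypotheses (lt_m'l : m' < l) (lt_2lk : 2 * l + 2 < k).

Let tD : transp_set D. Proof. exact: transp_set_of tG. Qed.

Let GD : G \subset 'N(D).
Proof.
rewrite -(transp_gen tG) gen_subG; apply/subsetP => x xD.
rewrite inE; apply/subsetP => y /imsetP[z zD ->]; exact: (transp_setJ tD).
Qed.

Let DG : D \subset G. Proof. by rewrite -(transp_gen tG) subset_gen. Qed.

Let N := [set g in S :&: G | [forall (x | x \in D), near D x (x ^ g)]].

Let NP g : reflect [/\ g \in S, g \in G & {in D, forall x, near D x (x ^ g)}]
                   (g \in N).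
Proof.
rewrite !inE -andbA; apply: (iffP and3P).
  by move=> [gS gG /forall_inP h].
by move=> [gS gG h]; split=> //; apply/forall_inP.
Qed.

Let JD x g : x \in D -> g \in G -> x ^ g \in D.
Proof. by move=> xD gG; rewrite memJ_norm // (subsetP GD). Qed.

Let near_trans' := near_trans tD.

Let group_set_N : group_set N.
Proof.
apply/group_setP; split=> [|g h /NP[gS gG gN] /NP[hS hG hN]].
  by apply/NP; split; rewrite ?group1 // => x _; rewrite conjg1 near_refl.
apply/NP; split; rewrite ?groupM // => x xD; rewrite conjgM.
by apply: (near_trans' xD (JD xD gG)); rewrite ?JD ?gN ?hN ?JD.
Qed.

(* If the commuting graph were disconnected, then N, the elements of S fixing each
   component, would contain c * d for adjacent c, d, but not d * e for d, e in
   different components. *)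
Lemma all_near d e : d \in D -> e \in D -> near D d e.
Proof.
move=> dD eD; apply: contraT => nde.
have SG : S \subset G.
  exact: normal_sub nSG.
have nN : Group group_set_N <| S.
  apply/andP; split; first by apply/subsetP => g /NP[].
  apply/subsetP => s sS; have sG := subsetP SG s sS.
  rewrite inE; apply/subsetP => _ /imsetP[g /NP[gS gG gN] ->].
  apply/NP; split; rewrite ?groupJ // => x xD.
  have xE : x = (x ^ s^-1) ^ s by rewrite conjgKV.
  rewrite {2}xE -conjJg {1}xE nearJ ?(subsetP GD) //.
  by rewrite gN // JD ?groupV.
have := srgset_card (loc dD) => ck.
have /card_gt0P[c cd] : 0 < #|nb D d| by rewrite ck; lia.
move: (cd); rewrite in_nb => /and3P[cD ndc dc].
have cdN : c * d \in Group group_set_N.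
  apply/NP; split; [exact: prodS|by rewrite groupM ?(subsetP DG)|].
  move=> x xD; have xcD : x ^ c \in D by exact: (transp_setJ tD).
  rewrite conjgM; have xcdD : (x ^ c) ^ d \in D by exact: (transp_setJ tD).
  (* Both [c] and [d] fix [d], so conjugation by them preserves its component. *)
  have near_d : near D d x -> near D d ((x ^ c) ^ d).
    move=> dx; rewrite -{1}(comP _ _ (com_refl d))
      nearJ ?(subsetP GD) ?(subsetP DG) //.
    by rewrite -(comP _ _ dc) nearJ ?(subsetP GD) ?(subsetP DG).
  case: (boolP (near D d x)) => dx.
    by apply: (near_trans' xD dD xcdD); rewrite ?near_d // near_sym.
  (* Outside the component of [d], [x] commutes with neither [c] nor [d], and [com_conj2] makes it
     commute with [(x ^ c) ^ d]. *)
  have xnd : ~~ com x d by apply: contra dx; rewrite /near comC => ->.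
  have xnc : ~~ com x c.
    apply: contra dx => xc; apply: (near_trans' dD cD xD).
      by rewrite /near dc.
    by rewrite /near comC xc.
  by rewrite /near (com_conj2 tD) // comC.
have [_ /(_ _ nN)[N1|NS]] := simpleP _ simS.
  have : c * d \in [1 gT] by rewrite -N1.
  move/set1P/eqP; rewrite -eq_invg_mul => /eqP cd1; case/negP: ndc.
  by rewrite -cd1 eq_sym eq_invg_mul (transp_set_inv tD).
(* Now [d] is near [d ^ (d * e) = d ^ e = e ^ d]; conjugation by [d] makes it near [e]. *)
have : d * e \in Group group_set_N by rewrite NS prodS.
case/NP=> _ _ /(_ d dD); rewrite conjgM (comP _ _ (com_refl d)) => h.
have nce : ~~ com d e by apply: contra nde; rewrite /near => ->.
case/negP: nde; move: h; rewrite (transp_set_braid tD) //.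
have dN : d \in 'N(D) by rewrite (subsetP GD) ?(subsetP DG).
by rewrite -{1}(comP _ _ (com_refl d)) nearJ.
Qed.

(** As [D] is one conjugacy class, the parameters found at a single [a] hold everywhere; [all_near]
    identifies its component with [D]. *)
Lemma fischer_srg : exists m n : nat,
  [/\ srgset D n k l m, (m * (n - (1 + k)) = k * (k - 1 - l))%N, (1 + k <= n)%N &
      exists T Q : nat,
  [/\ T + m * m' = m * l,
      Q + m * (m' * m') + m * ((1 + m') * m') = m * (l + m' * l' + m * m')
    & T * T <= (k - m) * Q]%N].
Proof.
have [a aG eD] : exists2 a, a \in G & D = a ^: G.
  by case/imsetP: (transp_class tG) => a aG ->; exists a.
have aD : a \in D by rewrite eD class_refl.
have [m [n2 [mn2 cn [e0 e0D /andP[ne0 /eqP me0]] mP]]] :=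
  component_param tD loc lt_m'l lt_2lk aD.
exists m, (1 + k + n2)%N; split.
- split.
  + rewrite -cn; apply: eq_card => x; rewrite inE.
    by case: (boolP (x \in D)) => // xD; rewrite all_near.
  + by move=> x xD; rewrite (srgset_card (loc xD)).
  + move=> x y xD yx; rewrite -nb_nb //.
    by rewrite (srgset_deg (loc xD)).
  + move=> x y; rewrite {1}eD => /imsetP[g gG ->] yD nc.
    have gN := subsetP GD g gG.
    have yD' : y ^ g^-1 \in D by rewrite JD ?groupV.
    move: nc; rewrite -(conjgKV g y); move: (y ^ g^-1) yD' => y0 y0D.
    rewrite comJ => nc; rewrite (nbJ a gN) (nbJ y0 gN) -conjIg cardJg.
    by rewrite mP ?all_near.
- by rewrite addKn.
- exact: leq_addr.
by rewrite -me0; apply: (common_nb_bound loc).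
Qed.

End Fischer.

(** * Transport of parameters along injections preserving commutation *)

Section Transport.
Variables (gT hT : finGroupType) (f : gT -> hT).
Implicit Types (E : {set gT}).

Definition com_inj E :=
  {in E &, injective f} /\ {in E &, forall x y, com (f x) (f y) = com x y}.

Lemma com_injS E (F : {set gT}) : E \subset F -> com_inj F -> com_inj E.
Proof.
by move=> /subsetP s [fi fc]; split=> x y /s xF /s yF; [apply: fi|apply: fc].
Qed.

Lemma nb_imset E x : com_inj E -> x \in E -> nb (f @: E) (f x) = f @: nb E x.
Proof.
move=> [fi fc] xE; apply/setP=> y; rewrite in_nb; apply/and3P/imsetP.
  move=> [/imsetP[z zE ->] zx xz]; exists z => //.
  rewrite in_nb zE -fc // xz andbT.
  by apply: contraNneq zx => ->.
move=> [z]; rewrite in_nb => /and3P[zE zx xz] ->.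
by rewrite imset_f // fc // (inj_in_eq fi).
Qed.

Lemma nbI_imset E x y : com_inj E -> x \in E -> y \in E ->
  nb (f @: E) (f x) :&: nb (f @: E) (f y) = f @: (nb E x :&: nb E y).
Proof.
move=> fE xE yE; rewrite !nb_imset // imsetI // => u v uX vY.
by case: fE => fi _; apply: fi; apply: (subsetP (nb_sub E _)); eassumption.
Qed.

Lemma card_imset_com E (X : {set gT}) : com_inj E -> X \subset E -> #|f @: X| = #|X|.
Proof.
move=> [fi _] /subsetP s; rewrite card_in_imset // => x y /s xE /s yE.
exact: fi.
Qed.

Lemma srgset_imset E n k l m : com_inj E ->
  srgset (f @: E) n k l m <-> srgset E n k l m.
Proof.
move=> fE; have cI x y : x \in E -> y \in E ->
  #|nb (f @: E) (f x) :&: nb (f @: E) (f y)| = #|nb E x :&: nb E y|.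
  move=> xE yE; rewrite nbI_imset // (card_imset_com fE) //.
  by apply: subset_trans (nb_sub E x); apply: subsetIl.
split=> -[cE dE lE mE].
  split=> [|x xE|x y xE yx|x y xE yE xy].
  - by rewrite -cE (card_imset_com fE).
  - by rewrite -(dE (f x)) ?imset_f // nb_imset // (card_imset_com fE) ?nb_sub.
  - have yE := subsetP (nb_sub E x) y yx.
    by rewrite -cI // lE ?imset_f // nb_imset // imset_f.
  by rewrite -cI // mE ?imset_f //; case: fE => _ ->.
split=> [|_ /imsetP[x xE ->]|_ y /imsetP[x xE ->]|
         _ _ /imsetP[x xE ->] /imsetP[y yE ->]].
- by rewrite (card_imset_com fE).
- by rewrite nb_imset // (card_imset_com fE) ?nb_sub // dE.
- rewrite {1}nb_imset // => /imsetP[z zx ->].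
  by rewrite cI ?lE // (subsetP (nb_sub E x)).
by case: (fE) => _ -> // xy; rewrite cI // mE.
Qed.

(** Local information of second order, used to rule out 198 common neighbours in the case of
    Fi_22. *)
Definition srg2set (rT : finGroupType) (E : {set rT}) n k l m :=
  forall x y, x \in E -> y \in E -> ~~ com x y ->
    srgset (nb E x :&: nb E y) n k l m.

Lemma srg2set_imset E n k l m : com_inj E ->
  srg2set (f @: E) n k l m <-> srg2set E n k l m.
Proof.
move=> fE; have sub x y : nb E x :&: nb E y \subset E.
  by apply: subset_trans (nb_sub E x); apply: subsetIl.
split=> h.
  move=> x y xE yE xy.
  apply/(srgset_imset _ _ _ _ (com_injS (sub x y) fE)).
  by rewrite -nbI_imset //; apply: h; rewrite ?imset_f //; case: fE => _ ->.
move=> _ _ /imsetP[x xE ->] /imsetP[y yE ->].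
case: (fE) => _ -> // xy; rewrite nbI_imset //.
by apply/(srgset_imset _ _ _ _ (com_injS (sub x y) fE)); apply: h.
Qed.

End Transport.

Lemma srgset_far (gT : finGroupType) (E : {set gT}) n k l m x :
  srgset E n k l m -> k.+1 < n -> x \in E -> exists2 y, y \in E & ~~ com x y.
Proof.
move=> S kn xE.
have /subsetPn[y yE] : ~~ (E \subset x |: nb E x).
  apply: contraL kn => /subset_leq_card.
  rewrite (srgset_card S) cardsU1 (srgset_deg S) // => h; rewrite -leqNgt.
  by apply: leq_trans h _; rewrite -add1n leq_add2r leq_b1.
rewrite in_setU1 in_nb negb_or yE => /andP[-> /= xy].
by exists y.
Qed.

(** * Central quotients, and links of transpositions *)

Section CentralQuotient.
Variables (gT : finGroupType) (Z : {group gT}) (E : {set gT}).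
Hypothesis ZE : E \subset 'C(Z).
Hypothesis EJ : forall x y, x \in E -> y \in E -> x ^ y \in E.
Hypothesis br : forall x y, x \in E -> y \in E -> ~~ com x y -> x ^ y = y ^ x.
Hypothesis far : forall x, x \in E -> exists2 y, y \in E & ~~ com x y.

Let EN x : x \in E -> x \in 'N(Z).
Proof. by move/(subsetP ZE); apply: (subsetP (cent_sub Z)). Qed.

(* If c = z * c' with z central, then x ^ c = x ^ c' for any x not commuting with
   c, that is, c ^ x = c' ^ x. *)
Lemma coset_com_inj : com_inj (coset Z) E.
Proof.
have inj : {in E &, injective (coset Z)}.
  move=> c c' cE c'E /(rcoset_kercosetP (EN cE) (EN c'E)) /rcosetP[z zZ ec].
  have [x xE cx] := far cE.
  have zC y : y \in E -> com y z.
    by move/(subsetP ZE)/centP/(_ z zZ) => yz; apply/eqP.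
  have c'x : ~~ com c' x.
    apply: contra cx => c'x; rewrite ec /com; apply/eqP.
    have /eqP zx := zC x xE; have /eqP e := c'x.
    by rewrite -mulgA e !mulgA zx.
  have xc' : x ^ c = x ^ c' by rewrite ec conjgM (comP _ _ (zC x xE)).
  apply: (conjg_inj x).
  by rewrite (br cE xE cx) (br c'E xE c'x) xc'.
split=> // c x cE xE; apply/idP/idP => [/comP|/eqP cx].
  rewrite -morphJ ?EN // => e.
  by apply/comP/inj; rewrite ?EJ.
by rewrite /com -!morphM ?EN // cx.
Qed.

Lemma quotient_imset : E / Z = coset Z @: E.
Proof.
rewrite /quotient morphimEsub //; apply/subsetP => x; exact: EN.
Qed.

End CentralQuotient.

Lemma isog_com_inj (gT hT : finGroupType) (G : {group gT}) (H : {group hT})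
    (f : {morphism G >-> hT}) (E : {set gT}) :
  isom G H f -> E \subset G -> com_inj f E.
Proof.
move=> /isomP[/injmP fi _] /subsetP EG; split=> [x y /EG xG /EG yG|x y /EG xG /EG yG].
  exact: fi.
by rewrite /com -!morphM // (inj_in_eq fi) // groupM.
Qed.

Section Link.
Variables (gT : finGroupType) (D : {set gT}) (d : gT).
Hypotheses (tD : transp_set D) (dD : d \in D).

Lemma link_cent : nb D d \subset 'C(<[d]>).
Proof.
rewrite cent_cycle; apply/subsetP => x; rewrite in_nb => /and3P[_ _].
by rewrite cent1_com comC.
Qed.

Lemma linkE : transp_link D d = coset <[d]> @: nb D d.
Proof.
rewrite -(quotient_imset link_cent) /transp_link.
suff -> : 'C_D[d] :\ d = nb D d by [].
by apply/setP=> x; rewrite in_nb in_setD1 in_setI cent1_com comC andbCA.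
Qed.

(** The parameters are known only in the quotient, so the noncommuting partner required by
    [coset_com_inj] is found there and lifted. *)
Lemma link_com_inj n k l m : srgset (transp_link D d) n k l m -> k.+1 < n ->
  com_inj (coset <[d]>) (nb D d).
Proof.
move=> S kn; apply: coset_com_inj; first exact: link_cent.
- move=> x y; rewrite !in_nb => /and3P[xD xd dx] /and3P[yD yd dy].
  rewrite (transp_setJ tD) //= -(comP _ _ dy) comJ dx andbT.
  by apply: contraNneq xd => /conjg_inj ->.
- move=> x y /(subsetP (nb_sub D d)) xD /(subsetP (nb_sub D d)) yD.
  exact: (transp_set_braid tD).
move=> c cd; have : coset <[d]> c \in transp_link D d.
  by rewrite linkE imset_f.
case/(srgset_far S kn) => y; rewrite linkE => /imsetP[x xd ->] nc.
have N z : z \in nb D d -> z \in 'N(<[d]>).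
  by move/(subsetP link_cent); apply: (subsetP (cent_sub _)).
exists x => //; apply: contra nc => /eqP cx.
by rewrite /com -!morphM ?N // cx.
Qed.

Lemma link_srgset n k l m : srgset (transp_link D d) n k l m -> k.+1 < n ->
  srgset (nb D d) n k l m.
Proof.
move=> S kn; apply/(srgset_imset _ _ _ _ (link_com_inj S kn)).
by rewrite -linkE.
Qed.

End Link.

Lemma transp_step (gT : finGroupType) (G S : {group gT}) (D : {set gT})
    (k l l' m' : nat) :
  is_3transp G D -> simple S -> S <| G ->
  (forall d e, d \in D -> e \in D -> d * e \in S) ->
  {in D, forall d, srgset (transp_link D d) k l l' m'} ->
  m' < l -> 2 * l + 2 < k ->
  exists m n : nat,
  [/\ srgset D n k l m, (m * (n - (1 + k)) = k * (k - 1 - l))%N, (1 + k <= n)%N &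
      exists T Q : nat,
  [/\ T + m * m' = m * l,
      Q + m * (m' * m') + m * ((1 + m') * m') = m * (l + m' * l' + m * m')
    & T * T <= (k - m) * Q]%N].
Proof.
move=> tG simS nS prodS L ml lk; have tD := transp_set_of tG.
apply: (fischer_srg tG simS nS) => // c cD.
by apply: link_srgset (L c cD) _ => //; lia.
Qed.

Lemma transp_mem (gT : finGroupType) (G : {group gT}) (D : {set gT}) d :
  is_3transp G D -> d \in D -> d \in G.
Proof. by move=> tG dD; rewrite -(transp_gen tG) mem_gen. Qed.

(** Writing [e] as [d ^ g], the product is the commutator of [d] and [g], because [d] is an
    involution. *)
Lemma transp_der (gT : finGroupType) (G : {group gT}) (D : {set gT}) d e :
  is_3transp G D -> d \in D -> e \in D -> d * e \in G^`(1).
Proof.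
move=> tG dD eD; have tD := transp_set_of tG.
have [g gG ->] : exists2 g, g \in G & e = d ^ g.
  case/imsetP: (transp_class tG) => a aG eDa.
  move: dD eD; rewrite eDa => /imsetP[x xG ->] /imsetP[y yG ->].
  by exists (x^-1 * y); rewrite ?groupM ?groupV // -conjgM mulKVg.
have -> : d * d ^ g = [~ d, g].
  rewrite commgEl; congr (_ * _).
  by apply/esym/eqP; rewrite eq_invg_mul (transp_set_inv tD).
by rewrite derg1 mem_commg // (transp_mem tG).
Qed.

End TranspositionSets.

(** * Eigenvalues of strongly regular graphs *)

Section SpectralTheory.
Import Order.TTheory GRing.Theory Num.Theory.
Local Open Scope ring_scope.

Lemma char_poly_conj (F : fieldType) n (P A : 'M[F]_n) : P \in unitmx ->
  char_poly (invmx P *m A *m P) = char_poly A.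
Proof.
move=> Pu; pose f := @map_mx _ _ (@polyC F) n n.
have fPP : f (invmx P) *m f P = 1%:M by rewrite -map_mxM mulVmx // map_mx1.
have eX : 'X%:M = f (invmx P) *m 'X%:M *m f P :> 'M_n.
  by rewrite mul_mx_scalar -scalemxAl fPP scalemx1.
rewrite /char_poly /char_poly_mx {1}eX !map_mxM -mulmxBl -mulmxBr !det_mulmx.
by rewrite mulrC mulrA -det_mulmx mulmx1C // det1 mul1r.
Qed.

Lemma sum_pm (I : finType) (S : pred I) (F : I -> algC) (D : algC) :
  (forall i, S i -> F i ^+ 2 = D ^+ 2) ->
  exists z : int, \sum_(i | S i) F i = z%:~R * D.
Proof.
move=> h; apply: (big_ind (fun x => exists z : int, x = z%:~R * D)).
- by exists 0; rewrite mul0r.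
- move=> x y [z ->] [t ->]; exists (z + t); by rewrite intrD mulrDl.
move=> i /h /eqP; rewrite eqf_sqr => /orP[] /eqP ->.
  by exists 1; rewrite mul1r.
by exists (-1); rewrite mulN1r.
Qed.

Section Spectrum.
Variables (T : finType) (e : rel T) (n k l m : nat).
Hypotheses (e_sym : symmetric e) (e_irr : irreflexive e).
Hypothesis e_card : #|T| = n.
Hypothesis e_deg : regular_graph e k.
Hypothesis e_lam : forall x y, e x y -> #|[set z | e x z && e y z]| = l.
Hypothesis e_mu :
  forall x y, x != y -> ~~ e x y -> #|[set z | e x z && e y z]| = m.
Hypotheses (m_gt0 : (0 < m)%N) (n_gt0 : (0 < n)%N).
(** The identity k(k - 1 - l) = m(n - 1 - k), free of subtraction. *)
Hypothesis e_count : (k * k + m + m * k = k + l * k + m * n)%N.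

Let A := adj_mx e.
Let P := spectralmx A.
Let d i := spectral_diag A 0 i.
Let sg : algC := l%:R - m%:R.
(** The quadratic whose roots are the possible eigenvalues other than the simple eigenvalue [k]. *)
Let q (t : algC) := t ^+ 2 - sg * t - (k%:R - m%:R).

Let sum_T (F : T -> nat) : \sum_(i < #|T|) (F (enum_val i))%:R =
  (\sum_x F x)%:R :> algC.
Proof. by rewrite natr_sum [RHS](reindex _ (onW_bij _ (@enum_val_bij T))). Qed.

Let sum_pred (F : pred T) : (\sum_x (F x : nat) = #|[set x | F x]|)%N.
Proof.
by rewrite -sum1_card [RHS]big_mkcond; apply: eq_bigr => x _; rewrite inE; case: (F x).
Qed.

Let Asym : A^T = A.
Proof. by apply/matrixP => i j; rewrite !mxE e_sym. Qed.

Let AE : A = invmx P *m diag_mx (spectral_diag A) *m P.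
Proof.
apply/orthomx_spectralP; apply: symmetric_normalmx.
  by apply/is_hermitianmxP; rewrite expr0 scale1r map_mx_id // Asym.
by apply/mxOverP => i j; rewrite mxE realn.
Qed.

Let AA : A *m A = (k%:R - m%:R)%:M + sg *: A + const_mx m%:R.
Proof.
apply/matrixP => i j; rewrite !mxE.
under eq_bigr do rewrite !mxE -natrM mulnb (e_sym _ (enum_val j)).
rewrite (sum_T (fun z => e (enum_val i) z && e (enum_val j) z)) sum_pred.
case: (eqVneq i j) => [->|ij].
  rewrite e_irr mulr0 addr0 mulr1n subrK -(e_deg (enum_val j)).
  by congr (_%:R); apply: eq_card => z; rewrite !inE andbb.
rewrite mulr0n add0r; case: (boolP (e _ _)) => eij.
  by rewrite e_lam // mulr1 subrK.
by rewrite e_mu ?mulr0 ?add0r // (inj_eq enum_val_inj).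
Qed.

Let AJ : A *m const_mx 1 = const_mx k%:R :> 'M_(_, #|T|).
Proof.
apply/matrixP => i j; rewrite !mxE.
under eq_bigr do rewrite !mxE mulr1.
by rewrite (sum_T (e (enum_val i))) sum_pred e_deg.
Qed.

Let tr_diag : \sum_i d i = 0.
Proof.
transitivity (\tr A); last first.
  by rewrite /mxtrace big1 // => i _; rewrite mxE e_irr.
by rewrite AE mxtrace_mulC mulmxA mulmxV ?spectral_unit // mul1mx mxtrace_diag.
Qed.

Let tr_diag2 : \sum_i d i ^+ 2 = n%:R * k%:R.
Proof.
transitivity (\tr (A *m A)); last first.
  rewrite AA !mxtraceD mxtraceZ mxtrace_scalar.
  have -> : \tr A = 0 by rewrite /mxtrace big1 // => i _; rewrite mxE e_irr.
  have -> : \tr (const_mx m%:R : 'M[algC]_#|T|) = m%:R *+ #|T|.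
    rewrite /mxtrace; under eq_bigr do rewrite mxE.
    by rewrite sumr_const card_ord.
  by rewrite mulr0 addr0 -mulrnDl subrK e_card mulr_natl.
rewrite {1 2}AE !mulmxA mulmxK ?spectral_unit // mxtrace_mulC !mulmxA.
rewrite mulmxV ?spectral_unit // mul1mx mulmx_diag mxtrace_diag.
by apply: eq_bigr => i _; rewrite mxE.
Qed.

(** For a left eigenvector [x], the equation for A^2 gives q(d) x = m x J, with J the all-one
    matrix. Multiplying by A and using JA = kJ yields d q(d) x = k q(d) x. *)
Let d_root i : (d i - k%:R) * q (d i) = 0.
Proof.
pose x := row i P.
have xA : x *m A = d i *: x.
  rewrite {1}AE /x -row_mul !mulmxA mulmxV ?spectral_unit // mul1mx.
  apply/rowP => j; rewrite !mxE (bigD1 i) //= !mxE eqxx mulr1n.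
  rewrite big1 ?addr0 // => s si.
  by rewrite !mxE eq_sym (negPf si) mulr0n mul0r.
have x0 : x != 0.
  apply/eqP => /(congr1 (mulmx^~ (invmx P))).
  rewrite /x rowE mulmxK ?spectral_unit // mul0mx => /rowP/(_ i) /eqP.
  by rewrite !mxE !eqxx oner_eq0.
have JA : const_mx 1 *m A = const_mx k%:R :> 'M_#|T|.
  by apply: trmx_inj; rewrite trmx_mul Asym !trmx_const AJ.
have qx : q (d i) *: x = x *m const_mx m%:R.
  have : x *m (A *m A) = d i ^+ 2 *: x.
    by rewrite mulmxA xA -scalemxAl xA scalerA.
  rewrite AA !mulmxDr mul_mx_scalar -scalemxAr xA scalerA => E.
  by rewrite /q 2!scalerBl -E [_ + x *m _]addrC addrA !addrK.
have Jm c : const_mx c = c *: const_mx 1 :> 'M[algC]_#|T|.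
  by apply/matrixP => s t; rewrite !mxE mulr1.
apply/eqP; have : ((d i - k%:R) * q (d i)) *: x == 0.
  rewrite mulrBl scalerBl subr_eq0 mulrC -!scalerA -xA scalemxAl qx.
  by rewrite (Jm m%:R) -mulmxA -!scalemxAl JA (Jm k%:R) !scalemxAr !scalerA mulrC.
by rewrite scaler_eq0 (negPf x0) orbF.
Qed.

Let qk : q k%:R = n%:R * m%:R.
Proof.
have := congr1 (fun x => x%:R : algC) e_count.
rewrite !natrD !natrM => E; rewrite /q /sg.
by apply: (addIr (k%:R + l%:R * k%:R)); rewrite [RHS]addrC [n%:R * _]mulrC -E; ring.
Qed.

Let nm0 : n%:R * m%:R != 0 :> algC.
Proof. by rewrite -natrM pnatr_eq0 -lt0n muln_gt0 n_gt0. Qed.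

(* Summing q over the spectrum gives tr (A^2) - (k - m) n = n m = q(k). *)
Let simple_k : exists i0, d i0 = k%:R /\ forall i, i != i0 -> q (d i) = 0.
Proof.
have qE i : q (d i) = if d i == k%:R then n%:R * m%:R else 0.
  have /eqP := d_root i; rewrite mulf_eq0 subr_eq0.
  by case: eqP => [->|_ /= /eqP].
have : \sum_i q (d i) = n%:R * m%:R.
  rewrite /q !sumrB -mulr_sumr tr_diag tr_diag2 mulr0 subr0.
  by rewrite !sumr_const !card_ord !e_card -[k%:R *+ n]mulr_natl -[m%:R *+ n]mulr_natl; ring.
under eq_bigr do rewrite qE.
rewrite -big_mkcond sumr_const -[RHS]mulr1n => /eqP.
rewrite -[X in X == _]mulr_natr -[X in _ == X]mulr_natr.
rewrite (inj_eq (mulfI nm0)) eqr_nat => /card1P[i0 hi0].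
exists i0; split; first by apply/eqP; have := hi0 i0; rewrite !inE eqxx.
move=> i ii0; have hi : (d i == k%:R) = false.
  by have := hi0 i; rewrite [RHS]inE (negPf ii0).
by rewrite qE hi.
Qed.

(** Away from [i0], each [2 * d i - sg] is plus or minus the square root [D] of the discriminant. As
    the trace is 0, their sum is both [u * D] and -(2k + (n - 1)(l - m)); the claim is its
    square. *)
Lemma srg_integrality : exists u : int,
  u ^+ 2 * ((l%:Z - m%:Z) ^+ 2 + 4 * (k%:Z - m%:Z)) =
    (2 * k%:Z + (n%:Z - 1) * (l%:Z - m%:Z)) ^+ 2.
Proof.
have [i0 [di0 h]] := simple_k.
pose D := sqrtC (sg ^+ 2 + 4 * (k%:R - m%:R)).
have [|u uE] := @sum_pm _ (fun i => i != i0) (fun i => 2 * d i - sg) D.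
  by move=> i /h; rewrite sqrtCK /q => qi; rewrite -[RHS]addr0 -(mulr0 4) -qi; ring.
exists u; apply: (@intr_inj algC).
have E : u%:~R * D = - (2 * k%:R + (n%:R - 1) * sg).
  rewrite -uE sumrB -mulr_sumr.
  have -> : \sum_(i | i != i0) d i = - k%:R.
    have := tr_diag; rewrite (bigD1 i0) //= di0 => /eqP.
    by rewrite addrC addr_eq0 => /eqP.
  have -> : \sum_(i < #|T| | i != i0) sg = (n%:R - 1) * sg.
    by rewrite sumr_const cardC1 card_ord e_card -[sg *+ _]mulr_natl -subn1 natrB.
  by rewrite mulrN opprD.
have := congr1 (fun x => x ^+ 2) E; rewrite exprMn sqrtCK sqrrN => E2.
rewrite !(rmorphM, rmorphXn, rmorphD, rmorphB, rmorph1) /= -!pmulrn.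
rewrite !mulrNz -!pmulrn; move: E2; rewrite /sg => E2.
by transitivity ((2 * k%:R + (n%:R - 1) * (l%:R - m%:R)) ^+ 2 : algC);
  [rewrite -E2|]; ring.
Qed.

(** By Vieta [r] and [s] are the roots of [q]. Their actual multiplicities [a], [b] satisfy the same
    two linear equations as [f], [g], and these are independent because [r != s]. *)
Lemma srg_spectrum (r s : int) (f g : nat) :
  r + s = l%:Z - m%:Z -> r * s = m%:Z - k%:Z -> r != s ->
  (1 + f + g)%N = n -> k%:Z + f%:Z * r + g%:Z * s = 0 ->
  has_spectrum e k [:: (r, f); (s, g)].
Proof.
move=> rDs rMs r_s fgn fgk; split=> //.
have [i0 [di0 h]] := simple_k.
have drs i : i != i0 -> d i = if d i == r%:~R then r%:~R else s%:~R.
  move=> /h qi; have : (d i - r%:~R) * (d i - s%:~R) == 0.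
    have rDs' : r%:~R + s%:~R = sg :> algC by rewrite -intrD rDs intrB -!pmulrn.
    have rMs' : r%:~R * s%:~R = m%:R - k%:R :> algC.
      by rewrite -intrM rMs intrB -!pmulrn.
    rewrite -qi /q -rDs' -[k%:R - _]opprB -rMs'; apply/eqP; ring.
  by rewrite mulf_eq0 !subr_eq0; case: eqP => [->|_ /= /eqP].
pose a := #|[pred i | (i != i0) && (d i == r%:~R)]|.
pose b := #|[pred i | (i != i0) && (d i != r%:~R)]|.
have ab : (a + b)%N = (f + g)%N.
  have -> : (f + g)%N = #|[pred i | i != i0]|.
    by rewrite cardC1 card_ord e_card -fgn; lia.
  by rewrite -[RHS](cardID [pred i | d i == r%:~R]); congr (_ + _)%N;
    apply: eq_card => i; rewrite !inE andbC.
(* Stated for any commutative law, to serve both the trace and the product of linear factors. *)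
have rs_sum (R : Type) (idx : R) (op : Monoid.com_law idx) (F : algC -> R) :
    \big[op/idx]_i F (d i) =
    op (F k%:R) (op (\big[op/idx]_(i < a) F r%:~R) (\big[op/idx]_(i < b) F s%:~R)).
  rewrite (bigD1 i0) //= di0; congr (op _ _).
  rewrite (bigID (fun i => d i == r%:~R)) /=; congr (op _ _).
    rewrite big_const_ord -big_const; apply: eq_big => // i.
    by case/andP=> _ /eqP ->.
  rewrite big_const_ord -big_const; apply: eq_big => // i.
  by case/andP=> ii0 /negPf dr; rewrite (drs i ii0) dr.
have abk : k%:Z + a%:Z * r + b%:Z * s = 0.
  apply: (@intr_inj algC); have := rs_sum _ _ +%R id.
  rewrite tr_diag !sumr_const !card_ord mulr0z !intrD !intrM -!pmulrn !mulr_natl.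
  by rewrite /= addrA => <-.
have af : a = f.
  apply/eqP; have : (a%:Z - f%:Z) * (r - s) = 0.
    have abz : b%:Z = f%:Z + g%:Z - a%:Z by lia.
    by rewrite -[RHS](subrr 0) -{1}abk -{1}fgk abz; ring.
  by move/eqP; rewrite mulf_eq0 subr_eq0 [r - s == 0]subr_eq0 (negPf r_s) orbF.
have bg : b = g by move: ab; rewrite af => /addnI.
rewrite big_cons big_seq1 -/A AE char_poly_conj ?spectral_unit //.
rewrite char_poly_trig ?diag_mx_is_trig //.
under eq_bigr => i _ do rewrite mxE eqxx mulr1n -/(d i).
rewrite (rs_sum _ _ *%R (fun t => 'X - t%:P)) !prodr_const !card_ord.
by rewrite af bg.
Qed.

End Spectrum.

End SpectralTheory.

(** * Hermitian forms over F_4 and the transvections of SU_6(2) *)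

Section UnitaryGroup.
Import GRing.Theory.
Local Open Scope ring_scope.

Section Hermitian.
Variable F : finFieldType.
Hypotheses (card_F : #|F| = 4%N) (F2 : 2 \in [pchar F]).
Variable n : nat.
Implicit Types (a b c : F) (x y w : 'cV[F]_n) (ws : seq 'cV[F]_n).

Let addxx a : a + a = 0. Proof. exact: addrr_pchar2. Qed.
Let oppx a : - a = a. Proof. exact: oppr_pchar2. Qed.
Let x4 a : a ^+ 4 = a. Proof. by rewrite -card_F expf_card. Qed.
Let sqD a b : (a + b) ^+ 2 = a ^+ 2 + b ^+ 2.
Proof. by rewrite sqrrD mulr2n addxx addr0. Qed.

Definition f4tr a : F := a + a ^+ 2.

(** On the prime field {0, 1} this is the nontrivial additive character; [idem] expresses membership
    in that subfield, where [chiD] holds. *)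
Definition f4chi a : int := if a == 0 then 1 else -1.

Let idem a := a ^+ 2 = a.

Let idemP a : idem a -> a = 0 \/ a = 1.
Proof.
move=> ia; have /eqP : a * (a - 1) = 0 by rewrite mulrBr -expr2 ia mulr1 subrr.
by rewrite mulf_eq0 subr_eq0 => /orP[] /eqP; [left|right].
Qed.

Let idem_tr a : idem (f4tr a).
Proof. by rewrite /idem /f4tr sqD -exprM x4 addrC. Qed.

Let idemD a b : idem a -> idem b -> idem (a + b).
Proof. by rewrite /idem sqD => -> ->. Qed.

Let chiD a b : idem a -> idem b -> f4chi (a + b) = f4chi a * f4chi b.
Proof.
rewrite /f4chi => /idemP[] -> /idemP[] ->; rewrite ?addr0 ?add0r ?addxx //;
  by rewrite ?eqxx ?oner_eq0.
Qed.

Let trD a b : f4tr (a + b) = f4tr a + f4tr b.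
Proof. by rewrite /f4tr sqD addrACA. Qed.

Let tr_sq a : f4tr (a ^+ 2) = f4tr a.
Proof. by rewrite /f4tr -exprM x4 addrC. Qed.

Let tr_ex : exists a, f4tr a = 1.
Proof.
case: (pickP (fun a => f4tr a != 0)) => [a a0|h].
  by exists a; case: (idemP (idem_tr a)) a0 => -> //; rewrite eqxx.
have : (#|F| <= #|[set (0%R : F); 1%R]|)%N.
  apply: subset_leq_card; apply/subsetP => a _; rewrite !inE.
  have /eqP := negbFE (h a); rewrite /f4tr => /eqP; rewrite addr_eq0 oppx.
  by move=> /eqP /esym /idemP[] ->; rewrite eqxx ?orbT.
by rewrite card_F cards2; case: (_ != _).
Qed.

Let sum_chi_tr b : \sum_(a : F) f4chi (f4tr (a * b)) = if b == 0 then 4 else 0.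
Proof.
case: eqP => [->|/eqP b0].
  under eq_bigr do rewrite mulr0 /f4tr expr0n addr0 /f4chi eqxx.
  by rewrite sumr_const card_F.
have [a0 ta0] := tr_ex; set S := \sum_a _.
suff : S = - S by lia.
rewrite {1}/S (reindex_inj (addIr (a0 / b))) /= -sumrN; apply: eq_bigr => a _.
rewrite mulrDl divfK // trD chiD //.
by rewrite [f4chi (f4tr a0)]/f4chi ta0 oner_eq0 mulrN1.
Qed.

Let sum_chi_cube : \sum_(a : F) f4chi (a ^+ 3) = -2.
Proof.
rewrite (bigD1 0) //= expr0n /f4chi eqxx.
under eq_bigr do rewrite expf_eq0 /= ifN //.
by rewrite sumr_const cardC1 card_F.
Qed.

Definition hf x y : F := \sum_i x i 0 ^+ 2 * y i 0.
Definition hq x : F := hf x x.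

Lemma hfDl x1 x2 y : hf (x1 + x2) y = hf x1 y + hf x2 y.
Proof. by rewrite -big_split; apply: eq_bigr => i _; rewrite mxE sqD mulrDl. Qed.

Lemma hfDr x y1 y2 : hf x (y1 + y2) = hf x y1 + hf x y2.
Proof. by rewrite -big_split; apply: eq_bigr => i _; rewrite mxE mulrDr. Qed.

Lemma hfZl a x y : hf (a *: x) y = a ^+ 2 * hf x y.
Proof.
by rewrite [RHS]mulr_sumr; apply: eq_bigr => i _; rewrite mxE exprMn mulrA.
Qed.

Lemma hfZr a x y : hf x (a *: y) = a * hf x y.
Proof.
by rewrite [RHS]mulr_sumr; apply: eq_bigr => i _; rewrite mxE mulrCA.
Qed.

Lemma hf_sq x y : hf x y ^+ 2 = hf y x.
Proof.
rewrite /hf (big_morph (fun a => a ^+ 2) sqD (id1 := 0)) ?expr0n //.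
by apply: eq_bigr => i _; rewrite exprMn -exprM x4 mulrC.
Qed.

Lemma hf_eq0C x y : (hf x y == 0) = (hf y x == 0).
Proof. by rewrite -(hf_sq y) expf_eq0. Qed.

Let idem_hq x : idem (hq x). Proof. exact: hf_sq. Qed.

Lemma hqD x y : hq (x + y) = hq x + hq y + f4tr (hf x y).
Proof. by rewrite /hq /f4tr hf_sq !(hfDl, hfDr); ring. Qed.

Lemma hqZ a x : hq x = 0 -> hq (a *: x) = 0.
Proof. by rewrite /hq hfZl hfZr => ->; rewrite !mulr0. Qed.

(** The norm is the sum of the cubes of the coordinates, so the character sum is a product of [n]
    one-variable sums, each -2. *)
Let sum_chi_hq : \sum_x f4chi (hq x) = (-2) ^+ n.
Proof.
rewrite -sum_chi_cube -[in RHS](card_ord n) -prodr_const.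
rewrite bigA_distr_bigA /=.
pose g (f : {ffun 'I_n -> F}) : 'cV[F]_n := \col_i f i.
rewrite (reindex g) /=; last first.
  apply: onW_bij; exists (fun x => [ffun i => x i 0]) => [f|x].
    by apply/ffunP => i; rewrite ffunE mxE.
  by apply/colP => i; rewrite mxE ffunE.
apply: eq_bigr => f _.
have chi0 : f4chi 0 = 1 by rewrite /f4chi eqxx.
pose K (s : F) (p : int) := idem s /\ f4chi s = p.
suff h : K (hq (g f)) (\prod_i f4chi (f i ^+ 3)) by case: h.
rewrite /hq /hf; apply: (big_rec2 K); first by split; rewrite ?/idem ?expr0n.
move=> i p s _ [ids <-]; rewrite mxE -exprSr.
have ic : idem (f i ^+ 3).
  by rewrite /idem -exprM -[(3 * 2)%N]/(2 + 4)%N exprD x4 -exprSr.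
by split; [apply: idemD|rewrite chiD].
Qed.

Let sum_chi_hf y :
  \sum_x f4chi (f4tr (hf y x)) = if y == 0 then 4 ^+ n else 0.
Proof.
case: eqP => [->|/eqP y0].
  have h0 x : hf 0 x = 0 by rewrite -(scale0r 0) hfZl expr0n mul0r.
  under eq_bigr do rewrite h0 /f4tr expr0n addr0 /f4chi eqxx.
  by rewrite sumr_const card_mx card_F muln1 -natrX; lia.
have [i yi] : exists i, y i 0 != 0.
  case: (pickP (fun i => y i 0 != 0)) => [i yi|h]; first by exists i.
  by case/eqP: y0; apply/colP => i; rewrite mxE; have /eqP := negbFE (h i).
have [a0 ta0] := tr_ex; set S := \sum_x _.
suff : S = - S by lia.
pose x0 := (a0 / y i 0 ^+ 2) *: delta_mx i 0 : 'cV[F]_n.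
have hx0 : hf y x0 = a0.
  rewrite /hf (bigD1 i) //= !mxE !eqxx mulr1 mulrC divfK ?expf_neq0 //.
  by rewrite big1 ?addr0 // => j ji; rewrite !mxE (negPf ji) !mulr0.
rewrite {1}/S (reindex_inj (addIr x0)) /= -sumrN; apply: eq_bigr => x _.
rewrite hfDr trD chiD // hx0.
by rewrite [f4chi (f4tr a0)]/f4chi ta0 oner_eq0 mulrN1.
Qed.

(* These count the linear relations [y + \sum_i a_i w_i = 0], respectively sum the
   character of the norms of the vectors [y + \sum_i a_i w_i]. *)
Fixpoint lsum y ws : int :=
  if ws is w :: ws' then \sum_a lsum (y + a *: w) ws' else (y == 0)%:R.

Fixpoint qsum y ws : int :=
  if ws is w :: ws' then \sum_a qsum (y + a *: w) ws' else f4chi (hq y).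

Definition isos ws := [set x | (hq x == 0) && all (fun w => hf w x == 0) ws].

(** The factor [1 + f4chi (hq x)] is twice the indicator of isotropy; the twist by [y] lets the
    conditions in [ws] be removed one at a time. *)
Let hfS y ws := \sum_(x | all (fun w => hf w x == 0) ws)
   (1 + f4chi (hq x)) * f4chi (f4tr (hf y x)).

(** By induction on [ws]: four times the indicator of [hf w x = 0] is the sum over [a] of the
    characters of the trace of [hf (a *: w) x], which shifts [y] to [y + a *: w]. *)
Let hfSE y ws :
  4 ^+ size ws * hfS y ws = 4 ^+ n * lsum y ws + (-2) ^+ n * qsum y ws.
Proof.
elim: ws y => [|w ws IH] y.
  rewrite expr0 mul1r /hfS /=.
  under eq_bigr do rewrite mulrDl mul1r.
  rewrite big_split /= sum_chi_hf; congr (_ + _).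
    by case: (y == 0); rewrite ?mulr1 ?mulr0.
  (* Completing the square: under the shift of [x] by [y], the two traces of [hf x y] and [hf y x]
     cancel and the trace of [hq y] is 0. *)
  rewrite -sum_chi_hq mulr_suml (reindex_inj (addIr y)) /=.
  apply: eq_bigr => x _; rewrite hqD hfDr trD.
  rewrite (chiD (idemD (idem_hq x) (idem_hq y)) (idem_tr _)).
  rewrite (chiD (idem_hq x) (idem_hq y)) (chiD (idem_tr _) (idem_tr _)).
  rewrite -/(hq y) -(tr_sq (hf y x)) hf_sq.
  have c2 c : f4chi c * f4chi c = 1 by rewrite /f4chi; case: ifP.
  have -> : f4tr (hq y) = 0 by rewrite /f4tr idem_hq addxx.
  have -> : f4chi 0 = 1 by rewrite /f4chi eqxx.
  by rewrite mulr1 -mulrA c2 mulr1.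
rewrite [qsum y _]/= [lsum y _]/= [4 ^+ n * _]mulr_sumr.
rewrite [(-2) ^+ n * _]mulr_sumr -big_split /=.
under [RHS]eq_bigr do rewrite -IH.
rewrite -[RHS]mulr_sumr exprS -mulrA mulrCA; congr (_ * _).
rewrite exchange_big /= mulr_sumr [LHS]big_mkcond [RHS]big_mkcond /=.
apply: eq_bigr => x _; case: (all _ ws); rewrite ?andbF ?andbT //.
under eq_bigr => a _.
  rewrite hfDl hfZl trD chiD // -(tr_sq (a ^+ 2 * _)) exprMn -exprM x4 hf_sq.
  rewrite mulrA. over.
rewrite -mulr_sumr sum_chi_tr hf_eq0C; case: ifP => _; last by rewrite mulr0.
by rewrite mulrC.
Qed.

Lemma card_isos ws :
  4 ^+ size ws * (2 * #|isos ws|%:Z) = 4 ^+ n * lsum 0 ws + (-2) ^+ n * qsum 0 ws.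
Proof.
rewrite -hfSE; congr (_ * _).
rewrite /hfS -sum1_card -natz natr_sum mulr_sumr.
rewrite [LHS]big_mkcond [RHS]big_mkcond /=; apply: eq_bigr => x _.
rewrite inE.
have -> : hf 0 x = 0 by rewrite -(scale0r 0) hfZl expr0n mul0r.
rewrite /f4tr expr0n addr0 {2}/f4chi eqxx mulr1 /f4chi.
by case: (hq x == 0); case: (all _ _).
Qed.

Let hfx0 x : hf x 0 = 0.
Proof. by rewrite -(scale0r 0) hfZr mul0r. Qed.

Let perp ws x := all (fun w => hf w x == 0) ws.

Let perpD ws x y : perp ws x -> perp ws y -> perp ws (x + y).
Proof.
move=> /allP px /allP py; apply/allP => w wws.
by rewrite hfDr (eqP (px w wws)) (eqP (py w wws)) addr0.
Qed.

Let perpZ ws a x : perp ws x -> perp ws (a *: x).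
Proof.
by move=> /allP px; apply/allP => w wws; rewrite hfZr (eqP (px w wws)) mulr0.
Qed.

(* Satisfied by the empty family and by a hyperbolic pair. *)
Definition split_form ws (c : int) := forall y,
  all (fun w => hf w y == 0) ws ->
  lsum y ws = (y == 0)%:R /\ qsum y ws = c * f4chi (hq y).

Let sum_indep x y (z : 'cV[F]_n) :
  (forall a b, z + a *: x + b *: y = 0 -> [/\ z = 0, a = 0 & b = 0]) ->
  \sum_a \sum_b (z + a *: x + b *: y == 0%R)%:R = (z == 0%R)%:R :> int.
Proof.
move=> h; rewrite (bigD1 0) //= [X in X + _](bigD1 0) //= !scale0r !addr0.
rewrite !big1 ?addr0 // => [a a0|b b0].
  by rewrite big1 // => b _; case: eqP => // /h [_ e]; rewrite e eqxx in a0.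
case: eqP => // e; have := h 0 b; rewrite scale0r addr0 => /(_ e) [_ _ e'].
by rewrite e' eqxx in b0.
Qed.

Let hq2 x y a b : hq x = 0 -> hq y = 0 ->
  hq (a *: x + b *: y) = f4tr (b * (a ^+ 2 * hf x y)).
Proof. by move=> hx hy; rewrite hqD !hqZ // !add0r hfZl hfZr mulrCA. Qed.

(** The inner sum over [b] vanishes unless [a = 0], when it is 4. *)
Let sum_hyp x y : hq x = 0 -> hq y = 0 -> hf x y != 0 ->
  \sum_a \sum_b f4chi (hq (a *: x + b *: y)) = 4.
Proof.
move=> hx hy hxy.
under eq_bigr => a _.
  under eq_bigr do rewrite hq2 //.
  rewrite sum_chi_tr mulf_eq0 expf_eq0 (negPf hxy) orbF /=. over.
by rewrite -big_mkcond big_pred1_eq.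
Qed.

Let indep_hyp x y z : hq x = 0 -> hq y = 0 -> hf x y != 0 ->
  hf x z = 0 -> hf y z = 0 ->
  forall a b, z + a *: x + b *: y = 0 -> [/\ z = 0, a = 0 & b = 0].
Proof.
move=> hx hy hxy xz yz a b e.
have b0 : b = 0.
  have := congr1 (hf x) e; rewrite hfx0 !hfDr !hfZr xz -/(hq x) hx mulr0 !add0r.
  by move/eqP; rewrite mulf_eq0 (negPf hxy) orbF => /eqP.
have a0 : a = 0.
  have := congr1 (hf y) e; rewrite hfx0 !hfDr !hfZr yz -/(hq y) hy mulr0 add0r addr0.
  by move/eqP; rewrite mulf_eq0 hf_eq0C (negPf hxy) orbF => /eqP.
by move: e; rewrite a0 b0 !scale0r !addr0.
Qed.

Lemma split_nil : split_form [::] 1.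
Proof. by move=> y _; rewrite mul1r. Qed.

Lemma split_hyp x y : hq x = 0 -> hq y = 0 -> hf x y != 0 ->
  split_form [:: x; y] 4.
Proof.
move=> hx hy hxy z /= /and3P[/eqP xz /eqP yz _]; split.
  by apply: sum_indep; apply: indep_hyp.
under eq_bigr => a _.
  under eq_bigr => b _.
    have hz : hf z (a *: x + b *: y) = 0.
      apply/eqP; rewrite hf_eq0C hfDl !hfZl xz yz !mulr0 addr0 //.
    rewrite -addrA hqD hz /f4tr expr0n !addr0 chiD //. over.
  rewrite -mulr_sumr. over.
by rewrite -mulr_sumr sum_hyp // mulrC.
Qed.

Section SplitForm.
Variables (ws : seq 'cV[F]_n) (c : int).
Hypothesis ws_split : split_form ws c.

Let perp0 : perp ws 0.
Proof. by apply/allP => w _; rewrite hfx0. Qed.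

Lemma split_sum0 : lsum 0 ws = 1 /\ qsum 0 ws = c.
Proof. by case: (ws_split perp0) => -> ->; rewrite eqxx /hq hfx0 /f4chi eqxx mulr1. Qed.

Lemma split_sum1 x : x \in isos ws -> x != 0 ->
  lsum 0 (x :: ws) = 1 /\ qsum 0 (x :: ws) = 4 * c.
Proof.
rewrite inE => /andP[/eqP hx px] x0 /=; split.
  under eq_bigr => a _ do
    rewrite add0r (proj1 (ws_split (perpZ a px))) scaler_eq0 (negPf x0) orbF.
  by rewrite (bigD1 0) //= eqxx big1 ?addr0 // => a /negPf ->.
under eq_bigr => a _ do
  rewrite add0r (proj2 (ws_split (perpZ a px))) hqZ // /f4chi eqxx mulr1.
by rewrite sumr_const card_F; ring.
Qed.

(** On the plane spanned by [x] and [y] the norm is either identically 0, contributing 16, or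
    hyperbolic, contributing 4. *)
Lemma split_sum2 x y : x \in isos ws -> y \in isos ws ->
  (forall a b, a *: x + b *: y = 0 -> a = 0 /\ b = 0) ->
  lsum 0 (x :: y :: ws) = 1 /\
  qsum 0 (x :: y :: ws) = (if hf x y == 0 then 16 else 4) * c.
Proof.
rewrite !inE => /andP[/eqP hx px] /andP[/eqP hy py] ind.
have pxy a b : perp ws (0 + a *: x + b *: y).
  by rewrite add0r; apply: perpD; apply: perpZ.
split; rewrite [_ 0 _]/=.
  under eq_bigr => a _ do under eq_bigr => b _ do
    rewrite (proj1 (ws_split (pxy a b))).
  rewrite sum_indep ?eqxx // => a b; rewrite add0r => /ind[-> ->]; by split.
under eq_bigr => a _.
  under eq_bigr => b _ do rewrite (proj2 (ws_split (pxy a b))) add0r.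
  rewrite -mulr_sumr. over.
rewrite -mulr_sumr mulrC; congr (_ * _); case: eqP => [hxy|/eqP hxy].
  under eq_bigr => a _.
    under eq_bigr => b _ do
      rewrite hq2 // hxy !mulr0 /f4tr expr0n addr0 /f4chi eqxx.
    over.
  by rewrite sumr_const sumr_const card_F.
exact: sum_hyp.
Qed.

End SplitForm.

End Hermitian.

(** Two triangular factorizations of the block matrix with rows (1, -y) and (x, 1) are compared. *)
Lemma det_add1_mul (R : comNzRingType) n (x : 'cV[R]_n) (y : 'rV[R]_n) :
  \det (1%:M + x *m y) = 1 + (y *m x) 0 0.
Proof.
have E1 : block_mx (1%:M : 'M_1) 0 x 1%:M *m block_mx 1%:M (- y) 0 (1%:M + x *m y) =
          block_mx 1%:M (- y) x 1%:M.
  by rewrite mulmx_block !mul0mx !mul1mx !mulmx1 !addr0 mulmxN addrCA addNr addr0.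
have E2 : block_mx 1%:M (- y) 0 1%:M *m block_mx (1%:M + y *m x) 0 x 1%:M =
          block_mx (1%:M : 'M_1) (- y) x 1%:M.
  by rewrite mulmx_block !mul0mx !mul1mx !mulmx1 ?add0r ?addr0 mulNmx addrK.
have := congr1 determinant E1; rewrite -E2 !det_mulmx.
by rewrite !det_lblock !det_ublock !det1 !mul1r !mulr1 det_mx11 !mxE eqxx.
Qed.

Lemma rank1_mul (F : fieldType) m n (A : 'M[F]_(m, n)) : \rank A = 1%N ->
  exists x : 'cV_m, exists y : 'rV_n, A = x *m y.
Proof.
move=> r1; have := mulmx_base A; move: (col_base A) (row_base A).
by rewrite r1 => x y <-; exists x, y.
Qed.

Section Star.
Implicit Types (m n p : nat).

(** Extends [conj_tr] to rectangular matrices, so that it applies to vectors. *)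
Definition star m n (A : 'M[F4]_(m, n)) : 'M[F4]_(n, m) :=
  (map_mx (fun x => x ^+ 2) A)^T.

Let F2 := pchar_F4.
Let x4 (a : F4) : a ^+ 4 = a. Proof. by rewrite -{2}(expf_card a) card_F4. Qed.

Lemma starE m n (A : 'M[F4]_(m, n)) : star A = (map_mx (pFrobenius_aut F2) A)^T.
Proof. by apply/matrixP => i j; rewrite !mxE. Qed.

Lemma starM m n p (A : 'M_(m, n)) (B : 'M_(n, p)) :
  star (A *m B) = star B *m star A.
Proof. by rewrite !starE map_mxM trmx_mul. Qed.

Lemma starD m n (A B : 'M_(m, n)) : star (A + B) = star A + star B.
Proof. by rewrite !starE map_mxD raddfD. Qed.

Lemma star1 n : star (1%:M : 'M_n) = 1%:M.
Proof. by rewrite starE map_mx1 trmx1. Qed.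

Lemma starK m n (A : 'M_(m, n)) : star (star A) = A.
Proof. by apply/matrixP => i j; rewrite !mxE -exprM x4. Qed.

Lemma starZ m n a (A : 'M_(m, n)) : star (a *: A) = a ^+ 2 *: star A.
Proof. by apply/matrixP => i j; rewrite !mxE exprMn. Qed.

Lemma star_mul_hf n (x y : 'cV[F4]_n) : star x *m y = (hf x y)%:M.
Proof.
rewrite [LHS]mx11_scalar; congr _%:M.
by rewrite !mxE; apply: eq_bigr => i _; rewrite !mxE.
Qed.

Lemma mul_star_hf n (x y : 'cV[F4]_n) p (B : 'M[F4]_(1, p)) :
  star x *m (y *m B) = hf x y *: B.
Proof. by rewrite mulmxA star_mul_hf mul_scalar_mx. Qed.

Lemma star_dual n (x : 'cV[F4]_n) : x != 0 -> exists y : 'cV[F4]_n, hf x y = 1.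
Proof.
move=> x0; have [i xi] : exists i, x i 0 != 0.
  case: (pickP (fun i => x i 0 != 0)) => [i xi|h]; first by exists i.
  by case/eqP: x0; apply/colP => i; rewrite mxE; have /eqP := negbFE (h i).
exists ((x i 0 ^+ 2)^-1 *: delta_mx i 0).
rewrite /hf (bigD1 i) //= !mxE !eqxx mulr1 divff ?expf_neq0 //.
by rewrite big1 ?addr0 // => j ji; rewrite !mxE (negPf ji) !mulr0.
Qed.

End Star.

Section Transvections.
Local Notation V := 'cV[F4]_6.
Implicit Types (x y v w : V) (ws : seq V).

Let F2 := pchar_F4.
Let c4 := card_F4.
Let addxx (a : F4) : a + a = 0. Proof. exact: addrr_pchar2. Qed.
Let addMM m n (A : 'M[F4]_(m, n)) : A + A = 0.
Proof. by apply/matrixP => i j; rewrite !mxE addxx. Qed.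
Let x4 (a : F4) : a ^+ 4 = a. Proof. by rewrite -{2}(expf_card a) c4. Qed.
Let x3 (a : F4) : a != 0 -> a ^+ 3 = 1.
Proof. by move=> a0; apply: (mulfI a0); rewrite -exprS x4 mulr1. Qed.

Definition tmx v : 'M[F4]_6 := 1%:M + v *m star v.

Lemma tmx_star v : star (tmx v) = tmx v.
Proof. by rewrite starD star1 starM starK. Qed.

Lemma tmxM v w :
  tmx v *m tmx w = 1%:M + v *m star v + w *m star w + hf v w *: (v *m star w).
Proof.
rewrite /tmx mulmxDl mul1mx mulmxDr mulmx1 -!mulmxA mul_star_hf -scalemxAr.
by rewrite addrA [X in X + _ = _]addrAC.
Qed.

Lemma tmx_sqr v : hq v = 0 -> tmx v *m tmx v = 1%:M.
Proof.
move=> hv; rewrite tmxM [hf v v]hv scale0r addr0 -addrA addMM addr0 //.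
Qed.

(** The default 1 occurs only when [tmx v] is singular, which [GLval_tv] excludes for isotropic
    [v]. *)
Definition tv v : {'GL_6[F4]} := insubd (1%g : {'GL_6[F4]}) (tmx v).

Lemma GLval_tv v : hq v = 0 -> GLval (tv v) = tmx v.
Proof.
move=> hv; have := insubdK (1%g : {'GL_6[F4]}).
apply; rewrite unfold_in /=.
by case/mulmx1_unit: (tmx_sqr hv).
Qed.

Lemma GLval_inj (u u' : {'GL_6[F4]}) : GLval u = GLval u' -> u = u'.
Proof. exact: val_inj. Qed.

Lemma hfC0 v w : hf v w = 0 -> hf w v = 0.
Proof. by move=> h; apply/eqP; rewrite (hf_eq0C c4 F2) h. Qed.

Lemma tmx_eq v w : w != 0 -> tmx v = tmx w -> exists2 a : F4, a != 0 & w = a *: v.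
Proof.
move=> w0 /addrI e; have [z wz] := star_dual w0.
have ew : w = hf v z *: v.
  have := congr1 (mulmx^~ z) e; rewrite -!mulmxA !star_mul_hf !mul_mx_scalar.
  by rewrite wz scale1r.
exists (hf v z) => //; apply: contraNneq w0 => h.
by rewrite ew h scale0r.
Qed.

Lemma tmxZ a v : a != 0 -> tmx (a *: v) = tmx v.
Proof.
move=> a0; rewrite /tmx starZ -scalemxAl -scalemxAr scalerA -exprS x3 //.
by rewrite scale1r.
Qed.

Definition isov v := (v != 0) && (hq v == 0).

Let isovP v : isov v -> v != 0 /\ hq v = 0.
Proof. by case/andP => -> /eqP ->. Qed.

Lemma com_tv v w : isov v -> isov w -> com (tv v) (tv w) = (hf v w == 0).
Proof.
move=> /isovP[v0 hv] /isovP[w0 hw].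
have -> : com (tv v) (tv w) = (tmx v *m tmx w == tmx w *m tmx v).
  apply/eqP/eqP => [/(congr1 (@GLval 6 F4))|e].
    by rewrite !GL_ME !GLval_tv.
  by apply: GLval_inj; rewrite !GL_ME !GLval_tv.
rewrite !tmxM [1%:M + w *m _ + _]addrAC (inj_eq (addrI _)).
apply/eqP/eqP => [e|h]; last by rewrite h (hfC0 h) !scale0r.
apply/eqP; apply: contraNT w0 => h.
have h' : hf w v != 0 by rewrite (hf_eq0C c4 F2).
(* Applied to the isotropic vector [w], the left side vanishes and the right side is a nonzero
   multiple of [w]. *)
have := congr1 (mulmx^~ w) e; rewrite -!scalemxAl -!mulmxA !star_mul_hf.
rewrite [hf w w]hw !mul_mx_scalar scale0r scaler0 => /esym/eqP.
by rewrite !scaler_eq0 (negPf h) (negPf h').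
Qed.

Lemma tv_conj v w : isov v -> isov w ->
  isov (v + hf w v *: w) /\ (tv v ^ tv w)%g = tv (v + hf w v *: w).
Proof.
move=> iv iw; have [v0 hv] := isovP iv; have [w0 hw] := isovP iw.
set u := v + _; have ue : u = tmx w *m v.
  by rewrite /tmx mulmxDl mul1mx -mulmxA star_mul_hf mul_mx_scalar.
have ut : tmx u = tmx w *m tmx v *m tmx w.
  rewrite [tmx u]/tmx ue starM tmx_star -{1}(tmx_sqr hw).
  by rewrite [tmx v]/tmx mulmxDr mulmx1 mulmxDl !mulmxA.
have hu : hq u = 0.
  rewrite /u (hqD c4 F2) hv hqZ // !add0r hfZr -(hf_sq c4 F2 w v) /f4tr.
  by rewrite -exprS -exprM -[(3 * 2)%N]/(4 + 2)%N exprD x4 -exprS addxx.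
have iu : isov u.
  rewrite /isov hu eqxx andbT; apply: contraNneq v0 => u0.
  by rewrite -[v]mul1mx -(tmx_sqr hw) -mulmxA -ue u0 mulmx0.
split=> //; apply: (mulgI (tv w)); rewrite -conjgC; apply: GLval_inj.
rewrite (GL_ME (tv v)) (GL_ME (tv w)) (GLval_tv hu) (GLval_tv hv) (GLval_tv hw).
rewrite ut; transitivity (tmx v *m tmx w) => //.
transitivity (tmx w *m (tmx w *m tmx v *m tmx w)) => //.
by rewrite !mulmxA tmx_sqr // mul1mx.
Qed.

Lemma rank_tmx v : v != 0 -> \rank (v *m star v) = 1%N.
Proof.
move=> v0; apply/eqP; rewrite eqn_leq; apply/andP; split.
  by apply: leq_trans (mxrankM_maxl _ _) _; apply: rank_leq_col.
rewrite lt0n mxrank_eq0; apply: contra (v0) => /eqP e.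
have [z vz] := star_dual v0.
have := congr1 (mulmx^~ z) e.
by rewrite -mulmxA star_mul_hf vz mulmx1 mul0mx => ->.
Qed.

(** Write u - 1 = xy. Unitarity makes [star y] a multiple [t] of [x], determinant 1 makes [x]
    isotropic, and unitarity then reduces to t^2 + t = 0 with t nonzero, so t = 1. *)
Lemma SU6_2_transvectionsE : SU6_2_transvections = tv @: [set v | isov v].
Proof.
apply/setP => u; rewrite !inE; apply/idP/imsetP.
  case/andP=> /andP[/eqP uu /eqP du] /eqP ru.
  have [x [y exy]] := rank1_mul ru.
  have eu : GLval u = 1%:M + x *m y by rewrite -exy addrC subrK.
  have xy0 : x *m y != 0 by rewrite -mxrank_eq0 -exy ru.
  have x0 : x != 0 by apply: contraNneq xy0 => ->; rewrite mul0mx.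
  have [z xz] := star_dual x0.
  have E : x *m y + star y *m star x + x *m y *m (star y *m star x) = 0.
    have : (1%:M + x *m y) *m (1%:M + star y *m star x) = 1%:M.
      have -> : 1%:M + star y *m star x = star (GLval u).
        by rewrite eu starD star1 starM.
    by rewrite -eu; exact: uu.
    rewrite mulmxDl mul1mx mulmxDr mulmx1 -!addrA => /(canRL (addKr _)).
    by rewrite addNr addrCA addrA.
  pose t : F4 := - ((y + y *m star y *m star x) *m z) 0 0.
  have ey : star y = t *: x.
    have := congr1 (mulmx^~ z) E.
    rewrite mul0mx !mulmxDl -!mulmxA star_mul_hf xz mulmx1 => /eqP.
    rewrite addrAC addr_eq0 => /eqP e.
    rewrite -[star y]opprK -e -mulmxDr [_ + _]mx11_scalar mul_mx_scalar.
    rewrite -scaleNr; congr (- _ *: _).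
    by rewrite /t mulmxDl -!mulmxA star_mul_hf xz mulmx1.
  have {}ey : y = t ^+ 2 *: star x by rewrite -starZ -ey starK.
  have t0 : t != 0.
    by apply: contraNneq xy0 => t0; rewrite ey t0 expr0n scale0r mulmx0.
  have hx : hq x = 0.
    move: du; rewrite eu det_add1_mul ey -scalemxAl star_mul_hf !mxE eqxx mulr1n.
    by move/(canRL (addKr _)); rewrite addNr => /eqP;
      rewrite mulf_eq0 expf_eq0 (negPf t0) => /eqP.
  exists x; first by rewrite inE /isov x0 hx /=.
  apply: GLval_inj; rewrite GLval_tv // eu ey -scalemxAr; congr (_ + _).
  suff -> : t ^+ 2 = 1 by rewrite scale1r.
  move: E; rewrite ey starZ starK -exprM x4 -!scalemxAr -!scalemxAl -!mulmxA.
  rewrite -!scalemxAr mul_star_hf [hf x x]hx scale0r mulmx0 !scaler0 addr0 -scalerDl.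
  move/eqP; rewrite scaler_eq0 -mxrank_eq0 rank_tmx // orbF.
  rewrite -[X in _ + X]mul1r expr2 -mulrDl mulf_eq0 (negPf t0) orbF addr_eq0.
  by rewrite oppr_pchar2 // => /eqP ->; rewrite mulr1.
case=> v; rewrite inE => /isovP[v0 hv] ->; rewrite !GLval_tv //.
rewrite [conj_tr _]tmx_star tmx_sqr // eqxx det_add1_mul star_mul_hf mxE eqxx.
by rewrite mulr1n [hf v v]hv addr0 eqxx /= addrAC subrr add0r rank_tmx.
Qed.

Definition transv_perp ws := tv @: [set v in isos ws | v != 0].

(** A transvection arises from exactly the three nonzero multiples of its vector; the 1 counts the
    zero vector. *)
Lemma card_transv_perp ws : (#|isos ws| = 3 * #|transv_perp ws| + 1)%N.
Proof.
have i0 : 0 \in isos ws.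
  have h0 (w : V) : hf w 0 = 0 by rewrite -(scale0r 0) hfZr mul0r.
  by rewrite inE /hq h0 eqxx; apply/allP => w _; rewrite h0.
rewrite (cardsD1 0) i0 addnC; congr (_ + _)%N.
have -> : isos ws :\ 0 = [set v in isos ws | v != 0].
  by apply/setP => v; rewrite !inE andbC.
rewrite /transv_perp mulnC -sum_nat_const -sum1_card (partition_big_imset tv) /=.
apply: eq_bigr => u /imsetP[v]; rewrite inE => /andP[vi v0] ->.
have hv : hq v = 0 by move: vi; rewrite inE => /andP[/eqP].
transitivity #|(fun a => a *: v) @: [set a : F4 | a != 0]|; last first.
  rewrite card_imset => [|a b /eqP]; last first.
    by rewrite -subr_eq0 -scalerBl scaler_eq0 (negPf v0) orbF subr_eq0 => /eqP.
  have := cardC1 (0 : F4); rewrite c4 /= => <-.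
  by apply: eq_card => a; rewrite !inE.
rewrite sum1_card; apply: eq_card => w; rewrite unfold_in.
apply/andP/imsetP.
  rewrite inE => -[/andP[wi w0] /eqP e].
  have hw : hq w = 0 by move: wi; rewrite inE => /andP[/eqP].
  have [|a a0 ->] := @tmx_eq v w w0; last by exists a; rewrite ?inE.
  by rewrite -(GLval_tv hv) -(GLval_tv hw) e.
case=> a; rewrite inE => a0 ->; split.
  move: vi; rewrite !inE hqZ // eqxx scaler_eq0 negb_or a0 v0 !andbT /=.
  case/andP=> _ /allP h; apply/allP => x /h.
  by rewrite hfZr => /eqP ->; rewrite mulr0.
apply/eqP; apply: GLval_inj; rewrite !GLval_tv ?hqZ //.
exact: tmxZ.
Qed.

Lemma mem_transv_perp ws v : isov v ->
  (tv v \in transv_perp ws) = all (fun w => hf w v == 0) ws.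
Proof.
move=> iv; have [v0 hv] := isovP iv; apply/imsetP/idP => [[x]|pv]; last first.
  by exists v => //; rewrite !inE hv eqxx pv.
rewrite !inE => /andP[/andP[/eqP hx /allP px] x0] e.
have [|a a0 ->] := @tmx_eq x v v0.
  by rewrite -(GLval_tv hv) -(GLval_tv hx) e.
by apply/allP => w /px; rewrite hfZr => /eqP ->; rewrite mulr0.
Qed.

Lemma transv_perpP ws u : reflect
  (exists v, [/\ isov v, all (fun w => hf w v == 0) ws & u = tv v])
  (u \in transv_perp ws).
Proof.
apply: (iffP imsetP) => [[v]|[v [/isovP[v0 hv] pv ->]]]; last first.
  by exists v => //; rewrite !inE hv eqxx pv.
rewrite !inE => /andP[/andP[hv pv] v0] ->.
by exists v; rewrite /isov v0 hv.
Qed.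

Local Opaque tv transv_perp.

Lemma nb_transv_perp ws v : isov v ->
  nb (transv_perp ws) (tv v) = transv_perp (v :: ws) :\ tv v.
Proof.
move=> iv; apply/setP => u; rewrite in_nb in_setD1 andbCA; congr (_ && _).
apply/andP/transv_perpP => [[/transv_perpP[x [ix px ->]]]|[x [ix /= /andP[vx px] ->]]].
  by rewrite com_tv // => vx; exists x; rewrite /= vx.
by rewrite com_tv // mem_transv_perp.
Qed.

(** [card_isos] in dimension 6, where 4^6 = 4096 and (-2)^6 = 64. *)
Lemma transv_perp_card ws q (N : nat) : lsum 0 ws = 1 -> qsum 0 ws = q ->
  4 ^+ size ws * (2 * (3 * N%:Z + 1)) = 4096 + 64 * q -> #|transv_perp ws| = N.
Proof.
move=> l1 q1 e; have := card_isos c4 F2 ws; rewrite l1 q1 mulr1 card_transv_perp.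
have -> : 4 ^+ 6 + (-2) ^+ 6 * q = 4096 + 64 * q by [].
rewrite -e => /mulfI; rewrite expf_neq0 // => /(_ isT); lia.
Qed.

Lemma nbI_transv_perp ws v w : isov v -> isov w ->
nb (transv_perp ws) (tv v) :&: nb (transv_perp ws) (tv w) =
  transv_perp (v :: w :: ws) :\ tv v :\ tv w.
Proof.
move=> iv iw; rewrite !nb_transv_perp //; apply/setP => u.
rewrite !(in_setI, in_setD1).
have -> : (u \in transv_perp [:: v, w & ws]) =
    (u \in transv_perp (v :: ws)) && (u \in transv_perp (w :: ws)).
  apply/transv_perpP/andP => [[x [ix /= /and3P[vx wx px] ->]]|].
    by split; rewrite (mem_transv_perp _ ix); apply/andP.
  case=> /transv_perpP[x [ix /= /andP[vx px] ->]].
  rewrite (mem_transv_perp _ ix) => /andP[wx _]; exists x; split=> //.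
  by apply/and3P.
by case: (u == _); case: (u == _); rewrite ?andbF // andbACA.
Qed.

(** The offsets in [K + 1] and [L + 2] account for [v], respectively [v] and [w], which are
    perpendicular to themselves; if they do not commute, neither lies in the perp of the pair. *)
Lemma srgset_transv_perp ws c (N K L M : nat) : split_form ws c ->
  4 ^+ size ws * (2 * (3 * N%:Z + 1)) = 4096 + 64 * c ->
  4 ^+ (size ws).+1 * (2 * (3 * (K + 1)%:Z + 1)) = 4096 + 64 * (4 * c) ->
  4 ^+ (size ws).+2 * (2 * (3 * (L + 2)%:Z + 1)) = 4096 + 64 * (16 * c) ->
  4 ^+ (size ws).+2 * (2 * (3 * M%:Z + 1)) = 4096 + 64 * (4 * c) ->
  srgset (transv_perp ws) N K L M.
Proof.
move=> sp eN eK eL eM; have nbI := @nbI_transv_perp ws.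
have iso v : isov v -> all (fun w => hf w v == 0) ws -> v \in isos ws.
  by move=> /isovP[_ hv] pv; rewrite inE hv eqxx.
split.
- by have [] := split_sum0 sp => l q; apply: transv_perp_card l q _.
- move=> _ /transv_perpP[v [iv pv ->]]; rewrite nb_transv_perp //.
  have [] := split_sum1 c4 sp (iso v iv pv) (proj1 (isovP iv)) => l q.
  have := transv_perp_card l q eK; rewrite (cardsD1 (tv v)) mem_transv_perp //=.
  rewrite pv andbT; case: (isovP iv) => _ hv; rewrite [hf v v]hv eqxx => h.
  by apply: (@addnI 1); rewrite [RHS]addnC -h.
- move=> _ u /transv_perpP[v [iv pv ->]]; rewrite in_nb.
  case/and3P=> /transv_perpP[w [iw pw ->]] wv; rewrite com_tv // => vw.
  have ind (a b : F4) : a *: v + b *: w = 0 -> a = 0 /\ b = 0.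
    move=> e; have [b0|b0] := eqVneq b 0.
      move: e; rewrite b0 scale0r addr0 => /eqP.
      by rewrite scaler_eq0 (negPf (proj1 (isovP iv))) orbF => /eqP.
    case/eqP: wv; apply: GLval_inj; rewrite !GLval_tv ?(proj2 (isovP _)) //.
    have -> : w = (- (a / b)) *: v.
      apply: (scalerI b0); rewrite scalerA mulrN mulrCA divff // mulr1 scaleNr.
      by apply/eqP; rewrite -addr_eq0 addrC e.
    apply: tmxZ; rewrite oppr_eq0 mulf_neq0 ?invr_eq0 //.
    apply: contraNneq (proj1 (isovP iw)) => a0; move: e.
    rewrite a0 scale0r add0r => /eqP.
    by rewrite scaler_eq0 (negPf b0).
  have [] := split_sum2 c4 F2 sp (iso v iv pv) (iso w iw pw) ind => l q.
  rewrite vw in q; have := transv_perp_card l q eL.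
  rewrite nbI // (cardsD1 (tv v)) (cardsD1 (tv w)).
  rewrite in_setD1 wv !mem_transv_perp //= vw (hf_eq0C c4 F2) vw pv pw.
  case: (isovP iv) => _ hv; case: (isovP iw) => _ hw.
  rewrite [hf v v]hv [hf w w]hw eqxx => h.
  by apply: (@addnI 2); rewrite [RHS]addnC -h.
move=> _ _ /transv_perpP[v [iv pv ->]] /transv_perpP[w [iw pw ->]].
rewrite com_tv // => vw.
have ind (a b : F4) : a *: v + b *: w = 0 -> a = 0 /\ b = 0.
  move=> e; have [v0 hv] := isovP iv; have [w0 hw] := isovP iw.
  have hx0 (x : V) : hf x 0 = 0 by rewrite -(scale0r 0) hfZr mul0r.
  have := congr1 (hf v) e; rewrite hfDr !hfZr hx0 [hf v v]hv mulr0 add0r.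
  move/eqP; rewrite mulf_eq0 (negPf vw) orbF => /eqP b0; split=> //.
  move/eqP: e; rewrite b0 scale0r addr0 scaler_eq0 (negPf v0) orbF.
  by move/eqP.
have [] := split_sum2 c4 F2 sp (iso v iv pv) (iso w iw pw) ind => l q.
rewrite (negPf vw) in q; have := transv_perp_card l q eM.
rewrite nbI // (cardsD1 (tv v)) (cardsD1 (tv w)).
rewrite in_setD1 !mem_transv_perp //= (negPf vw) (hf_eq0C c4 F2 w) (negPf vw).
by rewrite !andbF !add0n.
Qed.

Lemma transvections_perp : SU6_2_transvections = transv_perp [::].
Proof.
rewrite SU6_2_transvectionsE; apply/setP => u; apply/imsetP/transv_perpP.
  by case=> v; rewrite inE => iv ->; exists v.
by case=> v [iv _ ->]; exists v; rewrite ?inE.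
Qed.

Lemma srgset_transvections : srgset SU6_2_transvections 693 180 51 45.
Proof.
rewrite transvections_perp.
by apply: (srgset_transv_perp (@split_nil _ _)); rewrite [size _]/= ?exprS expr0; lia.
Qed.

(** Noncommuting transvections have vectors forming a hyperbolic pair, so [split_hyp] applies with
    constant 4. *)
Lemma srg2set_transvections : srg2set SU6_2_transvections 45 12 3 3.
Proof.
rewrite transvections_perp => _ _ /transv_perpP[v [iv _ ->]] /transv_perpP[w [iw _ ->]].
rewrite com_tv // => vw.
have -> : nb (transv_perp [::]) (tv v) :&: nb (transv_perp [::]) (tv w) =
          transv_perp [:: v; w].
  rewrite nbI_transv_perp //; apply/setP=> u; rewrite !in_setD1.
  have nvw : hf w v != 0 by rewrite (hf_eq0C c4 F2).
  have [->|_] := eqVneq u (tv v).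
    by rewrite mem_transv_perp //= (negPf nvw) !andbF.
  have [->|//] := eqVneq u (tv w).
  by rewrite mem_transv_perp //= (negPf vw).
have [_ hv] := isovP iv; have [_ hw] := isovP iw.
by apply: (srgset_transv_perp (split_hyp c4 F2 hv hw vw));
  rewrite [size _]/= ?exprS expr0; lia.
Qed.

Lemma transvectionsJ (x y : {'GL_6[F4]}) :
  x \in SU6_2_transvections -> y \in SU6_2_transvections ->
  (x ^ y)%g \in SU6_2_transvections.
Proof.
rewrite transvections_perp => /transv_perpP[v [iv _ ->]] /transv_perpP[w [iw _ ->]].
by have [iu ->] := tv_conj iv iw; rewrite mem_transv_perp.
Qed.

Lemma transvections_braid (x y : {'GL_6[F4]}) :
  x \in SU6_2_transvections -> y \in SU6_2_transvections -> ~~ com x y ->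
  (x ^ y = y ^ x)%g.
Proof.
rewrite transvections_perp => /transv_perpP[v [iv _ ->]] /transv_perpP[w [iw _ ->]].
rewrite com_tv // => vw.
have [iu ->] := tv_conj iv iw; have [iu' ->] := tv_conj iw iv.
have h : w + hf v w *: v = hf v w *: (v + hf w v *: w).
  rewrite scalerDr scalerA -(hf_sq c4 F2 v w) -exprS x3 // scale1r.
  by rewrite addrC.
case: (isovP iu) (isovP iu') => _ hu [_ hu'].
apply: GLval_inj; rewrite (GLval_tv hu) (GLval_tv hu') h.
by rewrite tmxZ.
Qed.

End Transvections.

Local Open Scope group_scope.

Lemma PSU6_2_com_inj :
  com_inj (coset 'Z(SU6_2)) SU6_2_transvections /\
  PSU6_2_transvections = coset 'Z(SU6_2) @: SU6_2_transvections.
Proof.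
have C : SU6_2_transvections \subset 'C('Z(SU6_2)).
  apply: subset_trans (_ : SU6_2 \subset _).
    by apply/subsetP => u; rewrite inE => /andP[].
  by rewrite centsC subsetIr.
split; last exact: quotient_imset.
apply: (coset_com_inj C); first exact: transvectionsJ.
  exact: transvections_braid.
by move=> x; apply: (srgset_far srgset_transvections).
Qed.

Lemma PSU6_2_srg : srgset PSU6_2_transvections 693 180 51 45 /\
  srg2set PSU6_2_transvections 45 12 3 3.
Proof.
have [ci ->] := PSU6_2_com_inj; split.
  by apply/(srgset_imset _ _ _ _ ci); apply: srgset_transvections.
by apply/(srg2set_imset _ _ _ _ ci); apply: srg2set_transvections.
Qed.

End UnitaryGroup.

(* ssrint takes over the key [%Z]. *)
Delimit Scope Z_scope with BZ.

(** * From commuting sets to codiagrams and diagrams *)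

Section FischerGroups.
Import GroupScope.

Section Codiagram.
Variables (gT : finGroupType) (G : {group gT}) (D : {set gT}).
Hypothesis tG : is_3transp G D.
Local Notation T := {d : gT | d \in D}.

Let tD : transp_set D. Proof. exact: transp_set_of tG. Qed.

Lemma diagramE (x y : T) : diagram D x y = ~~ com (val x) (val y).
Proof.
rewrite /diagram /=; case: (boolP (com _ _)) => [c|nc] /=.
  apply/negP => /eqP o3; have : #[val x * val y] %| 2.
    rewrite order_dvdn expg2 {1}(eqP c) mulgA -(mulgA (val y)).
    by rewrite (transp_set_inv tD (valP x)) mulg1 (transp_set_inv tD (valP y)).
  by rewrite o3.
have := transp_prod tG (valP x) (valP y); rewrite !inE => /or3P[] // /eqP o.
  have := expg_order (val x * val y); rewrite o expg1 => xy.
  have ey : val y = val x.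
    by rewrite -[LHS](mulKg (val x)) xy mulg1 invg_invol ?(transp_set_inv tD) ?(valP x).
  by case/negP: nc; rewrite ey com_refl.
have := expg_order (val x * val y); rewrite o expg2 => /invg_invol.
rewrite invMg !invg_invol ?(transp_set_inv tD) ?(valP x) ?(valP y) // => e.
by case/negP: nc; rewrite /com e.
Qed.

Lemma codiagramE (x y : T) : codiagram D x y = (val y \in nb D (val x)).
Proof.
rewrite /codiagram /= -/(diagram D x y) diagramE negbK in_nb (valP y) /=.
by rewrite eq_sym.
Qed.

Lemma card_sub (P : pred gT) : #|[set z : T | P (val z)]| = #|[set z in D | P z]|.
Proof.
rewrite -(card_imset _ val_inj); apply: eq_card => z; rewrite inE.
apply/imsetP/andP => [[x]|[zD Pz]]; first by rewrite inE => Px ->; rewrite (valP x).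
by exists (exist _ z zD); rewrite ?inE.
Qed.

Lemma card_sub_nb (x y : T) :
  #|[set z | codiagram D x z && codiagram D y z]| =
  #|nb D (val x) :&: nb D (val y)|.
Proof.
transitivity #|[set z : T | (val z \in nb D (val x)) && (val z \in nb D (val y))]|.
  by apply: eq_card => z; rewrite [LHS]inE [RHS]inE !codiagramE.
rewrite (card_sub (fun z => (z \in nb D (val x)) && (z \in nb D (val y)))).
apply: eq_card => z; rewrite in_setI inE.
by case: (boolP (z \in nb D (val x))) => [/(subsetP (nb_sub D _)) ->|]; rewrite ?andbF.
Qed.

Variables (n k l m : nat).
Hypothesis S : srgset D n k l m.

Let cnb x := x |: nb D x.

Let cnbE x z : x \in D -> z \in D -> (z \in cnb x) = com x z.
Proof.
move=> xD zD; rewrite in_setU1 in_nb zD /=.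
by have [->|] := eqVneq z x; rewrite ?com_refl.
Qed.

Let card_cnb x : x \in D -> #|cnb x| = k.+1.
Proof.
by move=> xD; rewrite cardsU1 (srgset_deg S) // in_nb eqxx andbF.
Qed.

Let cnbS x : x \in D -> cnb x \subset D.
Proof. by move=> xD; rewrite subUset sub1set xD nb_sub. Qed.

Lemma codiagram_sym : symmetric (codiagram D).
Proof.
by move=> x y; rewrite !codiagramE !in_nb (valP x) (valP y) eq_sym comC.
Qed.

Lemma codiagram_irr : irreflexive (codiagram D).
Proof. by move=> x; rewrite codiagramE in_nb eqxx andbF. Qed.

Lemma card_sub_transp : #|{: T}| = n.
Proof. by rewrite card_sig -(srgset_card S); apply: eq_card. Qed.

Lemma codiagram_deg : regular_graph (codiagram D) k.
Proof.
move=> x; rewrite -(srgset_deg S (valP x)).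
transitivity #|[set z : T | val z \in nb D (val x)]|.
  by apply: eq_card => z; rewrite [LHS]inE [RHS]inE codiagramE.
rewrite (card_sub (fun z => z \in nb D (val x))).
apply: eq_card => z; rewrite inE.
by case: (boolP (z \in nb D _)) => [/(subsetP (nb_sub D _)) ->|]; rewrite ?andbF.
Qed.

Lemma codiagram_lam x y : codiagram D x y ->
  #|[set z | codiagram D x z && codiagram D y z]| = l.
Proof.
by rewrite codiagramE card_sub_nb => xy; apply: (srgset_lam S (valP x)).
Qed.

Lemma codiagram_mu x y : x != y -> ~~ codiagram D x y ->
  #|[set z | codiagram D x z && codiagram D y z]| = m.
Proof.
rewrite codiagramE card_sub_nb in_nb (valP y) /= => xy.
rewrite (inj_eq val_inj) eq_sym xy /=.
by apply: (srgset_mu S (valP x) (valP y)).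
Qed.

Lemma diagram_sym : symmetric (diagram D).
Proof. by move=> x y; rewrite !diagramE comC. Qed.

Lemma diagram_irr : irreflexive (diagram D).
Proof. by move=> x; rewrite diagramE com_refl. Qed.

Lemma diagram_deg : regular_graph (diagram D) (n - (1 + k)).
Proof.
move=> x.
transitivity #|[set z : T | ~~ com (val x) (val z)]|.
  by apply: eq_card => z; rewrite [LHS]inE [RHS]inE diagramE.
rewrite (card_sub (fun z => ~~ com (val x) z)) add1n -(card_cnb (valP x)) -(srgset_card S).
have /setIidPr cI := cnbS (valP x).
rewrite -cI -cardsD; apply: eq_card => z; rewrite in_setD inE andbC.
by case: (boolP (z \in D)) => zD; rewrite ?andbF // cnbE // (valP x).
Qed.

(** Inclusion-exclusion: common neighbours in the diagram are the elements outside both closed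
    neighbourhoods [cnb]. *)
Let diagram_cap (x y : T) :
  (#|[set z | diagram D x z && diagram D y z]| + 2 * (1 + k) =
   n + #|cnb (val x) :&: cnb (val y)|)%N.
Proof.
have -> : #|[set z | diagram D x z && diagram D y z]| =
          #|D :\: (cnb (val x) :|: cnb (val y))|.
  transitivity #|[set z : T | ~~ com (val x) (val z) && ~~ com (val y) (val z)]|.
    by apply: eq_card => z; rewrite [LHS]inE [RHS]inE !diagramE.
  rewrite (card_sub (fun z => ~~ com (val x) z && ~~ com (val y) z)).
  apply: eq_card => z; rewrite in_setD in_setU inE andbC negb_or.
  by case: (boolP (z \in D)) => zD; rewrite ?andbF // !cnbE ?(valP x) ?(valP y).
have := cardsU (cnb (val x)) (cnb (val y)); rewrite !card_cnb ?(valP x) ?(valP y) //.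
have := cardsID (cnb (val x) :|: cnb (val y)) D; rewrite (srgset_card S).
have /setIidPr -> : cnb (val x) :|: cnb (val y) \subset D.
  by rewrite subUset !cnbS ?(valP x) ?(valP y).
have := subset_leq_card (subsetIl (cnb (val x)) (cnb (val y))).
rewrite card_cnb ?(valP x) ?(valP y) //; lia.
Qed.

Lemma diagram_lam x y : diagram D x y ->
  (#|[set z | diagram D x z && diagram D y z]| + 2 * (1 + k) = n + m)%N.
Proof.
rewrite diagramE => xy; rewrite diagram_cap; congr (_ + _)%N.
rewrite -(srgset_mu S (valP x) (valP y) xy); apply: eq_card => z.
rewrite !in_setI !in_setU1.
have [->|_] := eqVneq z (val x).
  rewrite !in_nb eqxx andbF /= (comC (val y)) (negPf xy) !andbF orbF.
  by apply/negbTE; apply: contraNneq xy => e; rewrite -?e ?e /= ?e com_refl.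
have [->|//] := eqVneq z (val y).
by rewrite !in_nb eqxx !andbF /= (negPf xy) !andbF.
Qed.

(** Commuting [x] and [y] both lie in the two closed neighbourhoods, which thus meet in l + 2
    elements; hence [2 * k] in place of [2 * (1 + k)]. *)
Lemma diagram_mu x y : x != y -> ~~ diagram D x y ->
  (#|[set z | diagram D x z && diagram D y z]| + 2 * k = n + l)%N.
Proof.
rewrite diagramE negbK => xy cxy; have := diagram_cap x y.
have yx : val y != val x by rewrite (inj_eq val_inj) eq_sym.
have ynb : val y \in nb D (val x) by rewrite in_nb (valP y) yx.
suff -> : #|cnb (val x) :&: cnb (val y)| = l.+2 by lia.
rewrite (cardsD1 (val x)) (cardsD1 (val y)) -(srgset_lam S (valP x) ynb).
rewrite in_setD1 yx !in_setI !cnbE ?(valP x) ?(valP y) // !com_refl (comC (val y)) cxy /=.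
rewrite -[RHS]/(1 + (1 + _))%N; congr (_ + (_ + _))%N; apply: eq_card => z.
rewrite !in_setD1 !in_setI !in_setU1 !in_nb.
by case: (z == val x); case: (z == val y); rewrite /= ?andbF.
Qed.

Section SrgConclusion.
Import GRing.Theory Num.Theory.
Local Open Scope ring_scope.
Hypotheses (m_gt0 : (0 < m)%N) (n_gt0 : (0 < n)%N).
Hypothesis count : (k * k + m + m * k = k + l * k + m * n)%N.

Lemma codiagram_integrality : exists u : int,
  u ^+ 2 * ((l%:Z - m%:Z) ^+ 2 + 4 * (k%:Z - m%:Z)) =
    (2 * k%:Z + (n%:Z - 1) * (l%:Z - m%:Z)) ^+ 2.
Proof.
exact: (srg_integrality codiagram_sym codiagram_irr card_sub_transp codiagram_deg
          codiagram_lam codiagram_mu).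
Qed.

(** Complementation sends the eigenvalues r, s to -1 - r, -1 - s with the same multiplicities. *)
Lemma srg_of_srgset (k' l' m' f g : nat) (r s r' s' : int) :
  (0 < m')%N ->
  (k' + (1 + k) = n)%N -> (l' + 2 * (1 + k) = n + m)%N -> (m' + 2 * k = n + l)%N ->
  r + s = l%:Z - m%:Z -> r * s = m%:Z - k%:Z -> r != s ->
  (1 + f + g)%N = n -> k%:Z + f%:Z * r + g%:Z * s = 0 ->
  r' = - 1 - s -> s' = - 1 - r ->
  is_srg (codiagram D) n k l m (r, f) (s, g)
  /\ is_srg (diagram D) n k' l' m' (r', g) (s', f)
  /\ has_spectrum (diagram D) k' [:: (r', g); (s', f)].
Proof.
move=> m'_gt0 ek el em rDs rMs r_s fgn fgk -> ->.
have spC := srg_spectrum codiagram_sym codiagram_irr card_sub_transp codiagram_deg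
  codiagram_lam codiagram_mu m_gt0 n_gt0 count rDs rMs r_s fgn fgk.
have dd : regular_graph (diagram D) k' by move=> x; rewrite diagram_deg -ek addnK.
have dl x y : diagram D x y -> #|[set z | diagram D x z && diagram D y z]| = l'.
  by move/diagram_lam => h; apply: (@addIn (2 * (1 + k))%N); rewrite h el.
have dm x y : x != y -> ~~ diagram D x y ->
    #|[set z | diagram D x z && diagram D y z]| = m'.
  move=> xy nxy; have h := diagram_mu xy nxy.
  by apply: (@addIn (2 * k)%N); rewrite h em.
have spD : has_spectrum (diagram D) k' [:: (- 1 - s, g); (- 1 - r, f)].
  apply: (srg_spectrum diagram_sym diagram_irr card_sub_transp dd dl dm) => //.
  - nia.
  - have -> : -1 - s + (-1 - r) = - 2 - (r + s) by ring.
    by rewrite rDs; lia.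
  - have -> : (-1 - s) * (-1 - r) = 1 + (r + s) + r * s by ring.
    by rewrite rDs rMs; lia.
  - by apply: contra r_s => /eqP /addrI /oppr_inj ->.
  - by rewrite -fgn addnAC.
  have -> : k'%:Z + g%:Z * (-1 - s) + f%:Z * (-1 - r) =
            k'%:Z + k%:Z - g%:Z - f%:Z - (k%:Z + f%:Z * r + g%:Z * s) by ring.
  by rewrite fgk; lia.
split; [split=> //|split=> //; split=> //].
- exact: codiagram_sym.
- exact: codiagram_irr.
- exact: card_sub_transp.
- exact: codiagram_lam.
- exact: codiagram_mu.
- exact: diagram_sym.
- exact: diagram_irr.
- exact: card_sub_transp.
Qed.

(** In u^2 d = v^2 with v nonzero, u is nonzero and divides v, so d is the square of the
    quotient. *)
Lemma codiagram_disc_sqr : (m <= k)%N ->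
  2 * k%:Z + (n%:Z - 1) * (l%:Z - m%:Z) <> 0 ->
  exists w : nat, (l%:Z - m%:Z) * (l%:Z - m%:Z) + 4 * (k%:Z - m%:Z) = w%:Z * w%:Z.
Proof.
move=> mk v0; have [u] := codiagram_integrality.
set d := _ + 4 * _; set v := _ + _ * (l%:Z - m%:Z) => e.
have d0 : 0 <= d by rewrite /d addr_ge0 ?sqr_ge0 // mulr_ge0 // subr_ge0 lez_nat.
have en : (`|u| ^ 2 * `|d| = `|v| ^ 2)%N.
  by rewrite -!abszX -abszM e.
have u_gt0 : (0 < `|u|)%N.
  rewrite absz_gt0; apply/eqP => u0; apply: v0.
  by move/esym/eqP: e; rewrite u0 expr0n mul0r expf_eq0 => /eqP.
have : (`|u| ^ 2 %| `|v| ^ 2)%N by rewrite -en dvdn_mulr.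
rewrite dvdn_pexp2r // => /dvdnP[w ew]; exists w.
have : (`|u| ^ 2 * `|d| = `|u| ^ 2 * w ^ 2)%N by rewrite en ew expnMn mulnC.
move/eqP; rewrite eqn_pmul2l ?expn_gt0 ?u_gt0 // => /eqP ed.
have : d = w%:Z * w%:Z by rewrite -(gez0_abs d0) ed -mulnn PoszM.
by rewrite /d expr2.
Qed.

End SrgConclusion.

End Codiagram.

(* The Cauchy-Schwarz bound, the divisibility condition, and the condition that
   the discriminant d be a square unless the two remaining eigenvalues have the
   same multiplicity, that is, v = 0. *)
Definition srg_test (k l l' m' m : Z) : bool :=
  (let T := m * (l - m') in
   let Q := m * (l + m' * l' + m * m') - m * (m' * m') - m * ((1 + m') * m') in
   let N := k * (k - 1 - l) in
   let n := 1 + k + N / m in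
   let v := 2 * k + (n - 1) * (l - m) in
   let d := (l - m) * (l - m) + 4 * (k - m) in
   [&& T * T <=? (k - m) * Q, N mod m =? 0 &
       (v =? 0) || (Z.sqrt d * Z.sqrt d =? d)])%BZ.

Fixpoint zall (p : Z -> bool) (n : nat) (i : Z) : bool :=
  if n is n'.+1 then p i && zall p n' (i + 1)%BZ else true.

Lemma zallP p n i : zall p n i ->
  forall j, (i <= j < i + Z.of_nat n)%BZ -> p j.
Proof.
elim: n i => [|n IH] i /=; first by move=> _ j; lia.
case/andP => pi /IH h j hj; have [<-//|ij] := Z.eq_dec i j.
by apply: h; lia.
Qed.

(** Runs through m = 1, ..., k in binary integers, so that evaluation is fast. *)
Definition srg_search (k l l' m' : Z) (s : seq Z) : bool :=
  zall (fun m => srg_test k l l' m' m ==> has (Z.eqb m) s) (Z.to_nat k) 1.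

Section Search.
Variables (gT : finGroupType) (G S : {group gT}) (D : {set gT}).
Variables (k l l' m' : nat).
Hypothesis tG : is_3transp G D.
Hypotheses (simS : simple S) (nS : S <| G).
Hypothesis prodS : forall d e, d \in D -> e \in D -> d * e \in S.
Hypothesis L : {in D, forall d, srgset (transp_link D d) k l l' m'}.
Hypotheses (lt_m'l : (m' < l)%N) (lt_2lk : (2 * l + 2 < k)%N).

Lemma transp_search (s : seq Z) :
  srg_search (Z.of_nat k) (Z.of_nat l) (Z.of_nat l') (Z.of_nat m') s ->
  exists m n : nat,
  [/\ srgset D n k l m, (m * (n - (1 + k)) = k * (k - 1 - l))%N, (1 + k <= n)%N,
      (0 < m)%N & has (Z.eqb (Z.of_nat m)) s].
Proof.
move=> search.
have [m [n [Sr mn kn [T [Q [eT eQ TQ]]]]]] :=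
  transp_step tG simS nS prodS L lt_m'l lt_2lk.
have m0 : (0 < m)%N.
  rewrite lt0n; apply/eqP => m0; have : (0 < k * (k - 1 - l))%N by rewrite muln_gt0; lia.
  by rewrite -mn m0.
have mk : (m <= k)%N.
  rewrite leqNgt; apply/negP => km; move: TQ.
  (* With this truncated difference the bound reads T^2 <= 0, whereas T = m(l - m') is positive. *)
  have -> : (k - m = 0)%N by lia.
  rewrite mul0n leqn0 muln_eq0 orbb => /eqP T0.
  move/eqP: eT; rewrite T0 add0n eqn_pmul2l // => /eqP; lia.
exists m, n; split=> //.
(* The differences get names before the passage to [Z], so that no truncated subtraction remains. *)
have [j ej] : exists j, n = (1 + k + j)%N by exists (n - (1 + k))%N; lia.
have [i ei] : exists i, k = (1 + l + i)%N by exists (k - (1 + l))%N; lia.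
have [h eh] : exists h, k = (m + h)%N by exists (k - m)%N; lia.
have mj : (m * j = k * i)%N.
  have -> : j = (n - (1 + k))%N by lia.
  by rewrite mn; congr (_ * _)%N; lia.
have count : (k * k + m + m * k = k + l * k + m * n)%N.
  have kk : (k * k = k * (1 + l + i))%N by rewrite -ei.
  by rewrite ej; lia.
have n0 : (0 < n)%N by lia.
have := zallP search (j := Z.of_nat m).
have hm : (1 <= Z.of_nat m < 1 + Z.of_nat (Z.to_nat (Z.of_nat k)))%BZ by lia.
move=> /(_ hm) /implyP; apply; rewrite /srg_test.
have kl : (Z.of_nat k - 1 - Z.of_nat l = Z.of_nat i)%BZ by lia.
have eN : (Z.of_nat k * (Z.of_nat k - 1 - Z.of_nat l) = Z.of_nat j * Z.of_nat m)%BZ.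
  by rewrite kl; lia.
have m0' : Z.of_nat m <> 0%BZ by lia.
rewrite eN Z.mod_mul // Z.div_mul //.
apply/and3P; split=> //.
  apply/Z.leb_le.
  have -> : (Z.of_nat m * (Z.of_nat l - Z.of_nat m') = Z.of_nat T)%BZ by lia.
  have -> : (Z.of_nat k - Z.of_nat m = Z.of_nat h)%BZ by lia.
  have {}TQ : (T * T <= h * Q)%N by move: TQ; rewrite {1}eh addKn.
  have -> : (Z.of_nat m * (Z.of_nat l + Z.of_nat m' * Z.of_nat l' +
    Z.of_nat m * Z.of_nat m') - Z.of_nat m * (Z.of_nat m' * Z.of_nat m') -
    Z.of_nat m * ((1 + Z.of_nat m') * Z.of_nat m') = Z.of_nat Q)%BZ by lia.
  lia.
case: Z.eqb_spec => [//|v0]; rewrite orFb; apply/Z.eqb_spec.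
have [|w ew] := codiagram_disc_sqr tG Sr m0 n0 count mk.
  by move=> v1; apply: v0; move: v1; rewrite ej; lia.
have -> : ((Z.of_nat l - Z.of_nat m) * (Z.of_nat l - Z.of_nat m) +
  4 * (Z.of_nat k - Z.of_nat m) = Z.of_nat w * Z.of_nat w)%BZ by lia.
by rewrite Z.sqrt_square //; lia.
Qed.

End Search.

Lemma search_Fi22 : srg_search 693 180 51 45 [:: 126; 198]%BZ.
Proof. by vm_compute. Qed.

Lemma search_Fi23 : srg_search 3510 693 180 126 [:: 351]%BZ.
Proof. by vm_compute. Qed.

Lemma search_Fi24 : srg_search 31671 3510 693 351 [:: 3240]%BZ.
Proof. by vm_compute. Qed.

(** * Exclusion of 198 common neighbours *)

Section Local.
Variables (gT : finGroupType) (E : {set gT}).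
Hypothesis tE : transp_set E.
Hypothesis loc : forall c, c \in E -> srgset (nb E c) 45 12 3 3.

Let near_set x := [set y in E | near E x y].

(* Here Cauchy-Schwarz gives m <= 18, and m * n2 = 45 * 32. *)
Lemma near_set_card x : x \in E -> 126 <= #|near_set x|.
Proof.
move=> xE; have [m [n2 [mn cn [e eE /andP[xe /eqP me]] _]]] :=
  component_param tE loc isT isT xE.
have [T [Q []]] := common_nb_bound loc xE eE xe; rewrite me => eT eQ TQ.
have m18 : m <= 18.
  have T9 : T = (9 * m)%N by lia.
  have Q3 : Q = (3 * (m * m))%N by lia.
  move: TQ; rewrite T9 Q3; case: (posnP m) => [->//|m0].
  have -> : (9 * m * (9 * m) = 81 * (m * m))%N by lia.
  have -> : ((45 - m) * (3 * (m * m)) = (45 - m) * 3 * (m * m))%N by lia.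
  by rewrite leq_pmul2r ?muln_gt0 ?m0 //; lia.
(* From m <= 18 and m * n2 = 1440 follows n2 >= 80, and 1 + 45 + 80 = 126. *)
rewrite /near_set cn; nia.
Qed.

(** Two components would need at least 252 elements; a single one would have n2 = 198 - 1 - 45 =
    152, which does not divide 1440. *)
Lemma local_card_neq198 : #|E| != 198.
Proof.
apply/eqP => c198; have /card_gt0P[x xE] : 0 < #|E| by rewrite c198.
have all_near y : y \in E -> near E x y.
  move=> yE; apply: contraT => nxy.
  have : #|near_set x :|: near_set y| <= 198.
    rewrite -c198; apply: subset_leq_card.
    by apply/subsetP => z; rewrite !inE => /orP[] /andP[].
  have -> : #|near_set x :|: near_set y| = (#|near_set x| + #|near_set y|)%N.
    rewrite cardsU; suff -> : near_set x :&: near_set y = set0.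
      by rewrite cards0 subn0.
    apply/setP => z; rewrite !inE; apply/negP => /andP[/andP[zE xz] /andP[_ yz]].
    case/negP: nxy; apply: (near_trans tE xE zE yE xz).
    by rewrite near_sym.
  by have := near_set_card xE; have := near_set_card yE; lia.
have [m [n2 [mn cn _ _]]] := component_param tE loc isT isT xE.
have : #|near_set x| = 198.
  rewrite -c198; apply: eq_card => y; rewrite inE.
  by case: (boolP (y \in E)) => // yE; rewrite all_near.
rewrite /near_set cn => n2E; have e : n2 = 152 by lia.
by move: mn; rewrite e; lia.
Qed.

End Local.

(** * The three sporadic groups, each resting on the previous one *)

Section Sporadic.
Variables (gT : finGroupType) (G : {group gT}) (D : {set gT}).

Lemma link_sub d : is_3transp G D -> transp_link D d \subset transp_cent G d.
Proof.
move=> tG; apply: quotientS; apply: subset_trans (subD1set _ _) _.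
by apply: setSI; rewrite -(transp_gen tG) subset_gen.
Qed.

Lemma Fi22_link d : is_Fi22 G D -> d \in D ->
  srgset (transp_link D d) 693 180 51 45 /\ srg2set (transp_link D d) 45 12 3 3.
Proof.
move=> [tG _ L] dD; have [f isf fD] := L d dD; have sL := link_sub d tG.
have ci := isog_com_inj isf sL; rewrite morphimEsub // in fD.
have [s1 s2] := PSU6_2_srg; rewrite -fD in s1 s2; split.
  by apply/(srgset_imset _ _ _ _ ci).
by apply/(srg2set_imset _ _ _ _ ci).
Qed.

(** The common neighbours of [d] and [e] form a set of 3-transpositions. Its local graph at [c] is
    the set of common neighbours of [d] and [e] inside [nb D c], described by [srg2set]. *)
Lemma Fi22_common_nb d e : is_Fi22 G D -> d \in D -> e \in D -> ~~ com d e ->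
  #|nb D d :&: nb D e| != 198.
Proof.
move=> F dD eD nc; have [tG _ _] := F; have tD := transp_set_of tG.
have sub : nb D d :&: nb D e \subset D.
  by apply: subset_trans (nb_sub D d); apply: subsetIl.
have JM u v : u \in nb D d :&: nb D e -> v \in nb D d :&: nb D e ->
    u ^ v \in nb D d :&: nb D e.
  rewrite !in_setI !in_nb => /andP[/and3P[uD ud du] /and3P[_ ue eu]].
  move=> /andP[/and3P[vD _ dv] /and3P[_ _ ev]].
  have {}dv := comP _ _ dv; have {}ev := comP _ _ ev.
  have neq w : w ^ v = w -> u != w -> u ^ v != w.
    by move=> wv; apply: contraNneq => h; apply/eqP/(conjg_inj v); rewrite h wv.
  rewrite (transp_setJ tD uD vD) !neq //= -{1}dv -{1}ev !comJ du eu //.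
apply: local_card_neq198.
  split=> [u uM|u v uM vM|u v uM vM uv].
  - exact: (transp_set_inv tD (subsetP sub u uM)).
  - exact: JM.
  - exact: (transp_set_braid tD (subsetP sub u uM) (subsetP sub v vM) uv).
move=> c cM; have cD := subsetP sub c cM; case/setIP: cM => dc ec.
have [s1 s2] := Fi22_link F cD.
have ci := link_com_inj tD s1 isT.
have {}s2 : srg2set (nb D c) 45 12 3 3.
  by apply/(srg2set_imset _ _ _ _ ci); rewrite -linkE.
have cd := nbC dD dc; have ce := nbC eD ec.
have := s2 d e cd ce nc; rewrite (nb_nb cd) (nb_nb ce).
suff -> : nb D c :&: nb D d :&: (nb D c :&: nb D e) = nb (nb D d :&: nb D e) c by [].
apply/setP => z; rewrite !in_setI !in_nb in_setI !in_nb.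
by case: (z \in D) => //=; rewrite ?andbF //; case: (z == d); case: (z == e);
   case: (com d z); case: (com e z); case: (z == c); case: (com c z).
Qed.

Lemma Fi22_srgset : is_Fi22 G D -> srgset D 3510 693 180 126.
Proof.
move=> F; have [tG sG _] := F.
have [] := @transp_search _ G G D 693 180 51 45 tG sG (normal_refl G) _ _ isT isT
  [:: 126; 198]%BZ search_Fi22.
- by move=> d e dD eD; rewrite groupM ?(transp_mem tG).
- by move=> d dD; case: (Fi22_link F dD).
move=> m [n [S mn kn m0]] /=; rewrite orbF => /orP[] /Z.eqb_spec hm.
  have m126 : m = 126 by lia.
  have n3510 : n = 3510 by move: mn; rewrite m126; lia.
  by rewrite m126 n3510 in S.
(* This value passes every numerical test, with n = 1 + 693 + 1792; a noncommuting pair then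
   contradicts [Fi22_common_nb]. *)
have m198 : m = 198 by lia.
have n2486 : n = 2486 by move: mn; rewrite m198; lia.
have /card_gt0P[d dD] : 0 < #|D| by rewrite (srgset_card S) n2486.
have [|e eD de] := srgset_far S _ dD; first by rewrite n2486.
case/eqP: (Fi22_common_nb F dD eD de).
by rewrite (srgset_mu S).
Qed.

End Sporadic.

Lemma Fi23_srgset (gT : finGroupType) (G : {group gT}) (D : {set gT}) :
  is_Fi23 G D -> srgset D 31671 3510 693 351.
Proof.
move=> [tG sG L].
have [] := @transp_search _ G G D 3510 693 180 126 tG sG (normal_refl G) _ _ isT isT
  [:: 351]%BZ search_Fi23.
- by move=> d e dD eD; rewrite groupM ?(transp_mem tG).
- by move=> d /L; apply: Fi22_srgset.
move=> m [n [S mn kn m0]] /=; rewrite orbF => /Z.eqb_spec hm.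
(* Gives [lia] the binary value of a large [nat] numeral. *)
have e1 : Z.of_nat 31671 = 31671%BZ by vm_compute.
have m351 : m = 351 by lia.
have n31671 : n = 31671 by move: mn; rewrite m351; lia.
by rewrite m351 n31671 in S.
Qed.

Lemma Fi24_srgset (gT : finGroupType) (G : {group gT}) (D : {set gT}) :
  is_Fi24 G D -> srgset D 306936 31671 3510 3240.
Proof.
move=> [tG sG _ L].
have e1 : Z.of_nat 31671 = 31671%BZ by vm_compute.
have e2 : Z.of_nat 306936 = 306936%BZ by vm_compute.
have [] := @transp_search _ G _ D 31671 3510 693 351 tG sG (der_normal 1 G) _ _ isT _
  [:: 3240]%BZ _.
- by move=> d e; apply: transp_der.
- by move=> d /L; apply: Fi23_srgset.
- by lia.
- by rewrite e1; apply: search_Fi24.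
move=> m [n [S mn kn m0]] /=; rewrite orbF => /Z.eqb_spec hm.
have m3240 : m = 3240 by lia.
have n306936 : n = 306936 by move: mn; rewrite m3240; nia.
by rewrite m3240 n306936 in S.
Qed.

End FischerGroups.

Theorem theorem6p21 :
  (forall (gT : finGroupType) (G : {group gT}) (D : {set gT}), is_Fi22 G D ->
     is_srg (codiagram D) 3510 693 180 126 (63%Z, 429) ((-9)%Z, 3080)
  /\ is_srg (diagram D) 3510 2816 2248 2304 (8%Z, 3080) ((-64)%Z, 429)
  /\ has_spectrum (diagram D) 2816 [:: (8%Z, 3080); ((-64)%Z, 429)])
  /\
  (forall (gT : finGroupType) (G : {group gT}) (D : {set gT}), is_Fi23 G D ->
     is_srg (codiagram D) 31671 3510 693 351 (351%Z, 782) ((-9)%Z, 30888)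
  /\ is_srg (diagram D) 31671 28160 25000 25344 (8%Z, 30888) ((-352)%Z, 782)
  /\ has_spectrum (diagram D) 28160 [:: (8%Z, 30888); ((-352)%Z, 782)])
  /\
  (forall (gT : finGroupType) (G : {group gT}) (D : {set gT}), is_Fi24 G D ->
     is_srg (codiagram D) 306936 31671 3510 3240
       (351%Z, 57477) ((-81)%Z, 249458)
  /\ is_srg (diagram D) 306936 275264 246832 247104
       (80%Z, 249458) ((-352)%Z, 57477)
  /\ has_spectrum (diagram D) 275264 [:: (80%Z, 249458); ((-352)%Z, 57477)]).
Proof.
split; [|split] => gT G D F.
- have [tG _ _] := F.
  by apply: (srg_of_srgset tG (Fi22_srgset F)); lia.
- have [tG _ _] := F.
  have e1 : Z.of_nat 31671 = 31671%BZ by vm_compute.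
  have e2 : Z.of_nat 28160 = 28160%BZ by vm_compute.
  have e3 : Z.of_nat 25000 = 25000%BZ by vm_compute.
  have e4 : Z.of_nat 25344 = 25344%BZ by vm_compute.
  have e5 : Z.of_nat 30888 = 30888%BZ by vm_compute.
  by apply: (srg_of_srgset tG (Fi23_srgset F)); lia.
have [tG _ _ _] := F.
have e1 : Z.of_nat 31671 = 31671%BZ by vm_compute.
have e2 : Z.of_nat 306936 = 306936%BZ by vm_compute.
have e3 : Z.of_nat 275264 = 275264%BZ by vm_compute.
have e4 : Z.of_nat 246832 = 246832%BZ by vm_compute.
have e5 : Z.of_nat 247104 = 247104%BZ by vm_compute.
have e6 : Z.of_nat 249458 = 249458%BZ by vm_compute.
have e7 : Z.of_nat 57477 = 57477%BZ by vm_compute.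
(* The counting identity contains the square of the codiagram degree, a product of two such
   numerals. *)
have e8 : (Z.of_nat 31671 * Z.of_nat 31671 = 1003052241)%BZ by vm_compute.
by apply: (srg_of_srgset tG (Fi24_srgset F)); lia.
Qed.
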